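(* Let $\mathsf{L}$ be one of the modal dependence logics having intuitionistic disjunction $\vee$ in its language, i.e. $\mathsf{L}\in\{\mathbf{MT_0},\mathbf{MID},\mathbf{MD}^\vee\}$. Let $\vec p,\vec q,\vec r$ be pairwise disjoint finite tuples of propositional variables, let $\phi$ be an $\mathsf{L}$-formula whose propositional variables are among $\vec p,\vec q$, and let $\psi$ be an $\mathsf{L}$-formula whose propositional variables are among $\vec q,\vec r$. If $\phi\vdash_{\mathsf L}\psi$, then there exists an $\mathsf{L}$-formula $\theta$ whose propositional variables are among $\vec q$ such that $\phi\vdash_{\mathsf L}\theta$ and $\theta\vdash_{\mathsf L}\psi$.
   Context: **Languages.** ($n\ge0$; $\alpha,\alpha_i,\beta$ range over the classical formulas of the respective logic; $=\!(\alpha_1,\dots,\alpha_n,\beta)$ is a dependence atom.) - $\mathbf{MT_0}$: classical formulas $\alpha::=p\mid\bot\mid\alpha\wedge\alpha\mid\alpha\otimes\alpha\mid\alpha\to\alpha\mid\Box\alpha\mid\Diamond\alpha$; formulas $\phi::=\alpha\mid\; =\!(\alpha_1,\dots,\alpha_n,\beta)\mid\phi\wedge\phi\mid\phi\otimes\phi\mid\phi\vee\phi\mid\phi\to\phi\mid\Box\phi\mid\Diamond\phi$. - $\mathbf{MID}$: the same without $\otimes$. - $\mathbf{MD}^\vee$: classical formulas $\alpha::=p\mid\bot\mid\neg\alpha\mid\alpha\wedge\alpha\mid\alpha\otimes\alpha\mid\Box\alpha\mid\Diamond\alpha$; formulas $\phi::=\alpha\mid\;=\!(\alpha_1,\dots,\alpha_n,\beta)\mid\phi\wedge\phi\mid\phi\otimes\phi\mid\phi\vee\phi\mid\Box\phi\mid\Diamond\phi$.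 In $\mathbf{MT_0}$ and $\mathbf{MID}$, $\neg\phi$ abbreviates $\phi\to\bot$ and $\phi\leftrightarrow\psi$ abbreviates $(\phi\to\psi)\wedge(\psi\to\phi)$; in $\mathbf{MD}^\vee$ negation is primitive and applies to classical formulas only. **Hilbert system of $\mathbf{MT_0}$.** Axioms: all instances in the language of 1. $\phi\to(\psi\to\phi)$; $(\phi\to(\psi\to\chi))\to((\phi\to\psi)\to(\phi\to\chi))$; $\phi\wedge\psi\to\phi$; $\phi\wedge\psi\to\psi$; $\phi\to(\chi\to(\phi\wedge\chi))$; $\phi\to\phi\vee\psi$; $\psi\to\phi\vee\psi$; $(\phi\to\chi)\to((\psi\to\chi)\to(\phi\vee\psi\to\chi))$; $\bot\to\phi$; 2. $(\alpha\to(\phi\vee\psi))\to(\alpha\to\phi)\vee(\alpha\to\psi)$; $\neg\neg\alpha\to\alpha$; 3. $\Box(\phi\to\psi)\to(\Box\phi\to\Box\psi)$; $\Box(\phi\to\psi)\to(\Diamond\phi\to\Diamond\psi)$; $\neg\Diamond\bot$; $\Diamond(\phi\vee\psi)\to(\Diamond\phi\vee\Diamond\psi)$; $(\Diamond\phi\to\Box\psi)\to\Box(\phi\to\psi)$; 4. $=\!(\alpha_1,\dots,\alpha_k,\beta)\leftrightarrow\big((\alpha_1\vee\neg\alpha_1)\wedge\dots\wedge(\alpha_k\vee\neg\alpha_k)\to(\beta\vee\neg\beta)\big)$ (right side read as $\beta\vee\neg\beta$ if $k=0$); 5. $\phi\to\phi\otimes\psi$; $(\phi\to\alpha)\to((\psi\to\alpha)\to(\phi\otimes\psi\to\alpha))$;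 $(\phi\to\chi)\to((\psi\to\theta)\to(\phi\otimes\psi\to\chi\otimes\theta))$; $\phi\otimes\psi\to\psi\otimes\phi$; $\phi\otimes(\psi\otimes\chi)\to(\phi\otimes\psi)\otimes\chi$; $\phi\otimes(\psi\vee\chi)\to(\phi\otimes\psi)\vee(\phi\otimes\chi)$; 6. $\neg\Box\alpha\to\Diamond\neg\alpha$; $\Box(\phi\vee\psi)\to(\Box\phi\vee\Box\psi)$. Rules: Modus Ponens and Necessitation $\phi/\Box\phi$. The system of $\mathbf{MID}$ is the same with formulas of $\mathbf{MID}$ and without group 5. For these two logics $\phi\vdash_{\mathsf L}\psi$ means $\psi$ is derivable from the assumption $\phi$, Necessitation being applied only to theorems (equivalently, $\phi\to\psi$ is a theorem). **Natural deduction system of $\mathbf{MD}^\vee$.** ($[\cdot]$ marks discharged assumptions; subderivations may use further undischarged assumptions unless stated otherwise.) - From $\phi$ and $\psi$ infer $\phi\wedge\psi$; from $\phi\wedge\psi$ infer $\phi$; from $\phi\wedge\psi$ infer $\psi$. - From $\neg\neg\alpha$ infer $\alpha$; from $\bot$ infer $\phi$; from a derivation of $\bot$ from $[\alpha]$ infer $\neg\alpha$; from $\alpha$ and $\neg\alpha$ infer $\bot$. - From $\Box\phi_1,\dots,\Box\phi_k$ ($k\ge0$) and a derivation of $\psi$ from $[\phi_1],\dots,[\phi_k]$ with no other undischarged assumptions, infer $\Box\psi$; from $\Diamond\phi$ and a derivation of $\psi$ from $[\phi]$ with no other undischarged assumptions, infer $\Diamond\psi$. - From $\neg\Box\alpha$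 infer $\Diamond\neg\alpha$; from $\Diamond\neg\alpha$ infer $\neg\Box\alpha$. - From $\phi$ infer $\phi\vee\psi$; from $\psi$ infer $\phi\vee\psi$; from $\phi\vee\psi$, a derivation of $\chi$ from $[\phi]$ and a derivation of $\chi$ from $[\psi]$, infer $\chi$. - From $\phi\otimes(\psi\vee\chi)$ infer $(\phi\otimes\psi)\vee(\phi\otimes\chi)$; from $\Diamond(\phi\vee\psi)$ infer $\Diamond\phi\vee\Diamond\psi$; from $\Box(\phi\vee\psi)$ infer $\Box\phi\vee\Box\psi$. - From $\phi$ infer $\phi\otimes\psi$; from $\phi\otimes\psi$ infer $\psi\otimes\phi$; from $\phi\otimes(\psi\otimes\chi)$ infer $(\phi\otimes\psi)\otimes\chi$; from $\phi\otimes\psi$, a derivation of $\alpha$ from $[\phi]$ and a derivation of $\alpha$ from $[\psi]$ ($\alpha$ classical), infer $\alpha$; from $\phi\otimes\psi$ and a derivation of $\chi$ from $[\psi]$, infer $\phi\otimes\chi$. - $=\!(\alpha_1,\dots,\alpha_k,\beta)$ and $\bigotimes_{v\in 2^{\{1,\dots,k\}}}(\alpha_1^{v(1)}\wedge\dots\wedge\alpha_k^{v(k)}\wedge(\beta\vee\neg\beta))$ may be inferred from each other, where $2=\{0,1\}$, $\gamma^1=\gamma$, $\gamma^0=\neg\gamma$. For $\mathbf{MD}^\vee$, $\phi\vdash_{\mathsf L}\psi$ means there is a derivation of $\psi$ whose only undischarged assumptions are $\phi$. *)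

(* Defs.v *)
From Stdlib Require List.
From mathcomp Require Import all_boot.
Set Implicit Arguments.
Unset Strict Implicit.
Unset Printing Implicit Defensive.

(** Propositional variables are natural numbers.  In each logic the classical
    formulas form a type of their own, so that dependence atoms (and negation in
    [MDv]) can be restricted to them, and they are identified with the formulas
    built by the same connectives through a coercion. *)

(** * MT0 and MID *)

(** The flag [t] tells whether the tensor is in the language:
    [t = true] is MT0 and [t = false] is MID. *)
Inductive hcform (t : bool) : Type :=
| HCVar of nat
| HCBot
| HCAnd of hcform t & hcform t
| HCTens of t & hcform t & hcform t
| HCImp of hcform t & hcform t
| HCBox of hcform t
| HCDia of hcform t.

Inductive hform (t : bool) : Type :=
| HVar of nat
| HBot
| HDep of seq (hcform t) & hcform t
| HAnd of hform t & hform t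
| HTens of t & hform t & hform t
| HOr of hform t & hform t
| HImp of hform t & hform t
| HBox of hform t
| HDia of hform t.

Arguments HCBot {t}.
Arguments HBot {t}.

Fixpoint hclassical (t : bool) (a : hcform t) : hform t :=
  match a with
  | HCVar x => HVar t x
  | HCBot => HBot
  | HCAnd a b => HAnd (hclassical a) (hclassical b)
  | HCTens h a b => HTens h (hclassical a) (hclassical b)
  | HCImp a b => HImp (hclassical a) (hclassical b)
  | HCBox a => HBox (hclassical a)
  | HCDia a => HDia (hclassical a)
  end.
Coercion hclassical : hcform >-> hform.

Fixpoint hcvars (t : bool) (a : hcform t) : seq nat :=
  match a with
  | HCVar x => [:: x]
  | HCBot => [::]
  | HCAnd a b | HCTens _ a b | HCImp a b => hcvars a ++ hcvars b
  | HCBox a | HCDia a => hcvars a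
  end.

Fixpoint hvars (t : bool) (f : hform t) : seq nat :=
  match f with
  | HVar x => [:: x]
  | HBot => [::]
  | HDep s b => flatten [seq hcvars a | a <- s] ++ hcvars b
  | HAnd f g | HTens _ f g | HOr f g | HImp f g => hvars f ++ hvars g
  | HBox f | HDia f => hvars f
  end.

Declare Scope hform_scope.
Delimit Scope hform_scope with hf.
Bind Scope hform_scope with hform.

Notation "f ==> g" := (HImp f g) : hform_scope.
Notation "f && g" := (HAnd f g) : hform_scope.
Notation "f || g" := (HOr f g) : hform_scope.
Notation "f *[ h ] g" := (HTens h f g)
  (at level 40, h at level 200, left associativity) : hform_scope.
Notation "~~ f" := (HImp f HBot) : hform_scope.

Definition hem (t : bool) (a : hcform t) : hform t := (a || ~~ a)%hf.

Fixpoint hconj (t : bool) (f : hform t) (s : seq (hform t)) : hform t :=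
  if s is g :: s' then (f && hconj g s')%hf else f.

Definition hdep_def (t : bool) (s : seq (hcform t)) (b : hcform t) : hform t :=
  if s is a :: s' then (hconj (hem a) [seq hem c | c <- s'] ==> hem b)%hf
  else hem b.

Definition hiff (t : bool) (f g : hform t) : hform t :=
  ((f ==> g) && (g ==> f))%hf.

Section HilbertAxioms.
Local Open Scope hform_scope.

Inductive haxiom (t : bool) : hform t -> Prop :=
| HA_K f g : haxiom (f ==> (g ==> f))
| HA_S f g k : haxiom ((f ==> (g ==> k)) ==> ((f ==> g) ==> (f ==> k)))
| HA_and1 f g : haxiom (f && g ==> f)
| HA_and2 f g : haxiom (f && g ==> g)
| HA_and f k : haxiom (f ==> (k ==> f && k))
| HA_or1 f g : haxiom (f ==> f || g)
| HA_or2 f g : haxiom (g ==> f || g)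
| HA_or f g k : haxiom ((f ==> k) ==> ((g ==> k) ==> (f || g ==> k)))
| HA_bot f : haxiom (HBot ==> f)
| HA_split (a : hcform t) f g :
    haxiom ((a ==> f || g) ==> (a ==> f) || (a ==> g))
| HA_dne (a : hcform t) : haxiom (~~ (~~ a) ==> a)
| HA_boxK f g : haxiom (HBox (f ==> g) ==> (HBox f ==> HBox g))
| HA_diaK f g : haxiom (HBox (f ==> g) ==> (HDia f ==> HDia g))
| HA_diabot : haxiom (~~ (HDia HBot))
| HA_diaor f g : haxiom (HDia (f || g) ==> HDia f || HDia g)
| HA_diabox f g : haxiom ((HDia f ==> HBox g) ==> HBox (f ==> g))
| HA_dep (s : seq (hcform t)) (b : hcform t) :
    haxiom (hiff (HDep s b) (hdep_def s b))
| HA_tens1 (h : t) f g : haxiom (f ==> f *[h] g)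
| HA_tensE (h : t) f g (a : hcform t) :
    haxiom ((f ==> a) ==> ((g ==> a) ==> (f *[h] g ==> a)))
| HA_tensmono (h : t) f g k l :
    haxiom ((f ==> k) ==> ((g ==> l) ==> (f *[h] g ==> k *[h] l)))
| HA_tensC (h : t) f g : haxiom (f *[h] g ==> g *[h] f)
| HA_tensA (h : t) f g k :
    haxiom (f *[h] (g *[h] k) ==> (f *[h] g) *[h] k)
| HA_tensor (h : t) f g k :
    haxiom (f *[h] (g || k) ==> (f *[h] g) || (f *[h] k))
| HA_nbox (a : hcform t) : haxiom (~~ (HBox a) ==> HDia (~~ a))
| HA_boxor f g : haxiom (HBox (f || g) ==> HBox f || HBox g).

End HilbertAxioms.

Inductive hder (t : bool) (G : seq (hform t)) : hform t -> Prop :=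
| HD_hyp f : List.In f G -> hder G f
| HD_ax f : haxiom f -> hder G f
| HD_mp f g : hder G (HImp f g) -> hder G f -> hder G g
| HD_nec f : hder [::] f -> hder G (HBox f).

(** * MDv *)

Inductive dcform : Type :=
| DCVar of nat
| DCBot
| DCNeg of dcform
| DCAnd of dcform & dcform
| DCTens of dcform & dcform
| DCBox of dcform
| DCDia of dcform.

Inductive dform : Type :=
| DVar of nat
| DBot
| DNeg of dcform
| DDep of seq dcform & dcform
| DAnd of dform & dform
| DTens of dform & dform
| DOr of dform & dform
| DBox of dform
| DDia of dform.

Fixpoint dclassical (a : dcform) : dform :=
  match a with
  | DCVar x => DVar x
  | DCBot => DBot
  | DCNeg a => DNeg a
  | DCAnd a b => DAnd (dclassical a) (dclassical b)
  | DCTens a b => DTens (dclassical a) (dclassical b)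
  | DCBox a => DBox (dclassical a)
  | DCDia a => DDia (dclassical a)
  end.
Coercion dclassical : dcform >-> dform.

Fixpoint dcvars (a : dcform) : seq nat :=
  match a with
  | DCVar x => [:: x]
  | DCBot => [::]
  | DCAnd a b | DCTens a b => dcvars a ++ dcvars b
  | DCNeg a | DCBox a | DCDia a => dcvars a
  end.

Fixpoint dvars (f : dform) : seq nat :=
  match f with
  | DVar x => [:: x]
  | DBot => [::]
  | DNeg a => dcvars a
  | DDep s b => flatten [seq dcvars a | a <- s] ++ dcvars b
  | DAnd f g | DTens f g | DOr f g => dvars f ++ dvars g
  | DBox f | DDia f => dvars f
  end.

Definition dem (b : dcform) : dform := DOr b (DNeg b).

Definition dsigned (v : bool) (a : dcform) : dform := if v then dclassical a else DNeg a.

Fixpoint valuations (k : nat) : seq bitseq :=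
  if k is k'.+1 then
    [seq true :: v | v <- valuations k'] ++ [seq false :: v | v <- valuations k']
  else [:: [::]].

Definition ddep_case (s : seq dcform) (b : dcform) (v : bitseq) : dform :=
  foldr DAnd (dem b) [seq dsigned va.1 va.2 | va <- zip v s].

(* Only used on nonempty sequences, as there are [2 ^ k > 0] valuations. *)
Fixpoint dtensors (s : seq dform) : dform :=
  match s with
  | [::] => DBot
  | [:: f] => f
  | f :: s' => DTens f (dtensors s')
  end.

Definition ddep_def (s : seq dcform) (b : dcform) : dform :=
  dtensors [seq ddep_case s b v | v <- valuations (size s)].

(* [dder G f]: there is a derivation of [f] all of whose undischarged
   assumptions are in [G]. *)
Inductive dder : seq dform -> dform -> Prop :=
| DD_hyp G f : List.In f G -> dder G f
| DD_andI G f g : dder G f -> dder G g -> dder G (DAnd f g)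
| DD_andE1 G f g : dder G (DAnd f g) -> dder G f
| DD_andE2 G f g : dder G (DAnd f g) -> dder G g
| DD_dne G (a : dcform) : dder G (DNeg (DCNeg a)) -> dder G a
| DD_botE G f : dder G DBot -> dder G f
| DD_negI G (a : dcform) : dder (dclassical a :: G) DBot -> dder G (DNeg a)
| DD_negE G (a : dcform) : dder G a -> dder G (DNeg a) -> dder G DBot
| DD_box G (D : seq dform) g :
    (forall f, List.In f D -> dder G (DBox f)) -> dder D g -> dder G (DBox g)
| DD_dia G f g : dder G (DDia f) -> dder [:: f] g -> dder G (DDia g)
| DD_negbox G (a : dcform) : dder G (DNeg (DCBox a)) -> dder G (DDia (DNeg a))
| DD_dianeg G (a : dcform) : dder G (DDia (DNeg a)) -> dder G (DNeg (DCBox a))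
| DD_orI1 G f g : dder G f -> dder G (DOr f g)
| DD_orI2 G f g : dder G g -> dder G (DOr f g)
| DD_orE G f g k :
    dder G (DOr f g) -> dder (f :: G) k -> dder (g :: G) k -> dder G k
| DD_tensor G f g k :
    dder G (DTens f (DOr g k)) -> dder G (DOr (DTens f g) (DTens f k))
| DD_diaor G f g : dder G (DDia (DOr f g)) -> dder G (DOr (DDia f) (DDia g))
| DD_boxor G f g : dder G (DBox (DOr f g)) -> dder G (DOr (DBox f) (DBox g))
| DD_tensI G f g : dder G f -> dder G (DTens f g)
| DD_tensC G f g : dder G (DTens f g) -> dder G (DTens g f)
| DD_tensA G f g k :
    dder G (DTens f (DTens g k)) -> dder G (DTens (DTens f g) k)
| DD_tensE G f g (a : dcform) :
    dder G (DTens f g) -> dder (f :: G) a -> dder (g :: G) a -> dder G a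
| DD_tensmono G f g k :
    dder G (DTens f g) -> dder (g :: G) k -> dder G (DTens f k)
| DD_depE G (s : seq dcform) (b : dcform) :
    dder G (DDep s b) -> dder G (ddep_def s b)
| DD_depI G (s : seq dcform) (b : dcform) :
    dder G (ddep_def s b) -> dder G (DDep s b).

(** * The three logics *)

Inductive logic : Type := MT0 | MID | MDv.

Definition formula (L : logic) : Type :=
  match L with MT0 => hform true | MID => hform false | MDv => dform end.

Definition vars (L : logic) : formula L -> seq nat :=
  match L with MT0 => @hvars true | MID => @hvars false | MDv => dvars end.

Definition entails (L : logic) : formula L -> formula L -> Prop :=
  match L with
  | MT0 => fun f g => @hder true [:: f] g
  | MID => fun f g => @hder false [:: f] g
  | MDv => fun f g => dder [:: f] g
  end.

Definition disjoint_seq (s1 s2 : seq nat) : Prop :=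
  forall x, x \in s1 -> x \notin s2.

(* Main.v *)
(* Every formula is interderivable with the disjunction of finitely many modal
   formulas in negation normal form, its resolutions.  Reading a formula as "some
   resolution holds throughout the team" gives a sound team semantics; taking
   for the team all models of a resolution of [phi] shows that each resolution
   of [phi] semantically entails a single resolution of [psi].  A tableau
   procedure for K then returns an interpolant of the two resolutions together
   with closed tableaux, which translate into derivations in each of the three
   systems.  [theta] is the disjunction of these interpolants. *)

From Stdlib Require List.
From HB Require Import structures.
From mathcomp Require Import all_boot.
From mathcomp Require Import zify.
Require Import Defs.
Set Implicit Arguments.
Unset Strict Implicit.
Unset Printing Implicit Defensive.

(** * Modal formulas in negation normal form *)

(** The obstacle is that the three systems share no disjunction usable inside a modal formula: the
    intuitionistic one is not classical, MID has no tensor and MDv no implication. A modal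
    disjunction is therefore read as [~a -> b] in MT0 and MID and as a tensor in MDv. The record
    [calculus] asks to eliminate it only towards falsum: that is all a closed tableau derives, and
    reductio, valid for classical formulas, turns such a refutation into an entailment between modal
    formulas. Teams are arbitrary predicates on trees, since a formula usually has infinitely many
    models and all of them must form one team. Support is defined from the lists of resolutions, and
    the usual team clauses are derived from it, so that soundness and the syntactic normal forms
    speak of the same lists. *)

Inductive nnf : Type :=
| NConst of bool
| NLit of bool & nat
| NAnd of nnf & nnf
| NOr of nnf & nnf
| NBox of nnf
| NDia of nnf.

Definition nnf_eq_dec (a b : nnf) : {a = b} + {a <> b}.
Proof. by decide equality; exact: eq_comparable. Defined.

HB.instance Definition _ := hasDecEq.Build nnf (compareP nnf_eq_dec).

Fixpoint ndual (a : nnf) : nnf :=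
  match a with
  | NConst b => NConst (~~ b)
  | NLit b x => NLit (~~ b) x
  | NAnd a b => NOr (ndual a) (ndual b)
  | NOr a b => NAnd (ndual a) (ndual b)
  | NBox a => NDia (ndual a)
  | NDia a => NBox (ndual a)
  end.

Fixpoint nvars (a : nnf) : seq nat :=
  match a with
  | NConst _ => [::]
  | NLit _ x => [:: x]
  | NAnd a b | NOr a b => nvars a ++ nvars b
  | NBox a | NDia a => nvars a
  end.

Fixpoint nsize (a : nnf) : nat :=
  match a with
  | NConst _ | NLit _ _ => 1
  | NAnd a b | NOr a b => (nsize a + nsize b).+1
  | NBox a | NDia a => (nsize a).+1
  end.

Lemma ndualK : involutive ndual.
Proof.
by elim=> //= [b|b x|a -> b ->|a -> b ->|a ->|a ->] //; rewrite negbK.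
Qed.

Lemma nvars_dual (a : nnf) : nvars (ndual a) = nvars a.
Proof. by elim: a => //= [a -> b ->|a -> b ->]. Qed.

(** Finite trees serve as pointed Kripke models, the label listing the variables true at the root.
    They suffice for K because a failed tableau search returns such a tree, with children supplied
    by the diamonds. *)
Inductive tree : Type := Node of seq nat & seq tree.

Definition label (t : tree) : seq nat := let: Node v _ := t in v.
Definition children (t : tree) : seq tree := let: Node _ ts := t in ts.

(* [forallb] and [existsb] rather than [all] and [has]: their specifications
   need no [eqType] structure on trees. *)
Fixpoint sat (a : nnf) (t : tree) : bool :=
  match a with
  | NConst b => b
  | NLit b x => (x \in label t) == b
  | NAnd a b => sat a t && sat b t
  | NOr a b => sat a t || sat b t
  | NBox a => List.forallb (sat a) (children t)
  | NDia a => List.existsb (sat a) (children t)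
  end.

Lemma sat_boxP (a : nnf) (t : tree) :
  sat (NBox a) t <-> forall u, List.In u (children t) -> sat a u.
Proof. exact: List.forallb_forall. Qed.

Lemma sat_diaP (a : nnf) (t : tree) :
  sat (NDia a) t <-> exists u, List.In u (children t) /\ sat a u.
Proof. exact: List.existsb_exists. Qed.

Lemma sat_dual (a : nnf) (t : tree) : sat (ndual a) t = ~~ sat a t.
Proof.
elim: a t => //= [b x t|a IHa b IHb t|a IHa b IHb t|a IH t|a IH t].
- by case: b (x \in _) => [] [].
- by rewrite IHa IHb negb_and.
- by rewrite IHa IHb negb_or.
- by elim: (children t) => //= u s ->; rewrite IH negb_and.
- by elim: (children t) => //= u s ->; rewrite IH negb_or.
Qed.

(** * Tableaux for K and interpolation *)

(** The propositional rules keep their principal formula and only membership matters, so that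
    weakening, contraction and exchange are all instances of [closed_sub]. [Closed_dia] is the modal
    rule of K, with [T] any choice of formulas whose boxes are available. *)
Inductive closed : seq nnf -> Prop :=
| Closed_false S : NConst false \in S -> closed S
| Closed_lit S b x : NLit b x \in S -> NLit (~~ b) x \in S -> closed S
| Closed_and S a b : NAnd a b \in S -> closed [:: a, b & S] -> closed S
| Closed_or S a b :
    NOr a b \in S -> closed (a :: S) -> closed (b :: S) -> closed S
| Closed_dia S T a :
    NDia a \in S -> {subset map NBox T <= S} -> closed (a :: T) -> closed S.

Lemma sub_cons (T : eqType) (a : T) (s1 s2 : seq T) :
  {subset s1 <= s2} -> {subset a :: s1 <= a :: s2}.
Proof.
by move=> s12 x; rewrite !inE => /orP[->|/s12 ->] //; rewrite orbT.
Qed.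

Lemma closed_sub (S S' : seq nnf) : {subset S <= S'} -> closed S -> closed S'.
Proof.
move=> sub cS; elim: cS S' sub => {S}
  [S h|S b x h1 h2|S a b h _ IH|S a b h _ IHa _ IHb|S T a h sT cT _] S' sub.
- exact/Closed_false/sub.
- exact: (Closed_lit (sub _ h1) (sub _ h2)).
- by apply: (Closed_and (sub _ h)); apply: IH; do 2!apply: sub_cons.
- by apply: (Closed_or (sub _ h)); [apply: IHa | apply: IHb]; apply: sub_cons.
- by apply: (Closed_dia (sub _ h) _ cT) => x /sT /sub.
Qed.

(** * Interpolants of a partitioned tableau *)

Definition lvars (S : seq nnf) : seq nat := flatten (map nvars S).

(** Stated by refutation: [c] follows from [S] and is inconsistent with [T]. In this form exchanging
    the sides amounts to dualising [c], so each tableau step has to be treated on the left only. *)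
Definition interpolant (S T : seq nnf) (c : nnf) : Prop :=
  [/\ {subset nvars c <= lvars S}, {subset nvars c <= lvars T},
      closed (ndual c :: S) & closed (c :: T)].

Definition satisfiable (S : seq nnf) : Prop := exists t, all (sat^~ t) S.

Definition decided (S T : seq nnf) : Prop :=
  satisfiable (S ++ T) \/ exists c, interpolant S T c.

Lemma interpolantC (S T : seq nnf) (c : nnf) :
  interpolant S T c -> interpolant T S (ndual c).
Proof. by case=> vS vT cS cT; split; rewrite ?ndualK ?nvars_dual. Qed.

Lemma decidedC (S T : seq nnf) : decided S T -> decided T S.
Proof.
case=> [[t]|[c /interpolantC i]]; last by right; exists (ndual c).
by rewrite all_cat andbC -all_cat; left; exists t.
Qed.

Definition undia (S : seq nnf) : seq nnf :=
  pmap (fun a => if a is NDia b then Some b else None) S.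
Definition unbox (S : seq nnf) : seq nnf :=
  pmap (fun a => if a is NBox b then Some b else None) S.

Lemma undiaP (S : seq nnf) (a : nnf) : (a \in undia S) = (NDia a \in S).
Proof.
elim: S => //= b S IH.
rewrite inE -IH; case: b => //= b; rewrite inE; congr orb.
by apply/eqP/eqP => [->|[]].
Qed.

Lemma unboxP (S : seq nnf) (a : nnf) : (a \in unbox S) = (NBox a \in S).
Proof.
elim: S => //= b S IH.
rewrite inE -IH; case: b => //= b; rewrite inE; congr orb.
by apply/eqP/eqP => [->|[]].
Qed.

Definition is_compound (a : nnf) : bool :=
  match a with NAnd _ _ | NOr _ _ => true | _ => false end.

Definition lsize (S : seq nnf) : nat := sumn (map nsize S).

Lemma lsize_cat (S T : seq nnf) : lsize (S ++ T) = lsize S + lsize T.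
Proof. by rewrite /lsize map_cat sumn_cat. Qed.

Lemma lsize_unbox (S : seq nnf) : lsize (unbox S) <= lsize S.
Proof. by rewrite /lsize; elim: S => // a S; case: a => /= *; lia. Qed.

Lemma lsize_undia (S : seq nnf) (a : nnf) :
  NDia a \in S -> lsize (a :: unbox S) < lsize S.
Proof.
rewrite /lsize; elim: S => //= b S IH; rewrite inE => /orP[/eqP<-|/IH] /=.
  by have := lsize_unbox S; rewrite /lsize /=; lia.
by case: b => /= *; lia.
Qed.

Lemma lvarsP (S : seq nnf) (x : nat) :
  reflect (exists2 a, a \in S & x \in nvars a) (x \in lvars S).
Proof. exact: flatten_mapP. Qed.

Lemma mem_lvars (S : seq nnf) (a : nnf) :
  a \in S -> {subset nvars a <= lvars S}.
Proof. by move=> aS x xa; apply/lvarsP; exists a. Qed.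

Lemma lvars_sub (S T : seq nnf) :
  (forall a, a \in S -> {subset nvars a <= lvars T}) ->
  {subset lvars S <= lvars T}.
Proof. by move=> h x /lvarsP[a /h sub /sub]. Qed.

(** Replacing a compound formula of [S] by its parts lowers the size. A conjunction leaves the
    interpolant unchanged. For a disjunction on the left, the branches yield [c] and [d], and
    [NOr c d] works: each branch of [S] entails one of them, and both refute [T]. *)
Lemma decided_compound (S T : seq nnf) :
  (forall S', lsize S' < lsize S -> decided S' T) ->
  has is_compound S -> decided S T.
Proof.
move=> IH /hasP[f fS cf].
have pS := perm_to_rem fS.
have sizeS : lsize S = nsize f + lsize (rem f S).
  by rewrite /lsize (perm_sumn (perm_map _ pS)).
have satS t : all (sat^~ t) S = sat f t && all (sat^~ t) (rem f S).
  by rewrite (perm_all _ pS).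
have subR : {subset rem f S <= S} by exact: mem_rem.
case: f fS cf {pS} sizeS satS subR => // a b fS _ sizeS satS subR.
- have [||[c [vS vT cS cT]]] := IH [:: a, b & rem (NAnd a b) S].
  + by rewrite sizeS /lsize /=; lia.
  + case=> t /=; rewrite andbA -[sat a t && _]/(sat (NAnd a b) t).
    by rewrite all_cat andbA -satS -all_cat; left; exists t.
  right; exists c; split=> //.
  + move=> x /vS; apply: lvars_sub => d.
    rewrite !inE => /or3P[/eqP->|/eqP->|/subR].
    * by move=> y ya; apply: (mem_lvars fS); rewrite /= mem_cat ya.
    * by move=> y ya; apply: (mem_lvars fS); rewrite /= mem_cat ya orbT.
    * exact: mem_lvars.
  + apply: (@Closed_and _ a b); first by rewrite inE fS orbT.
    apply: closed_sub cS => x; rewrite !inE => /or4P[->|->|->|/subR ->];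
    by rewrite ?orbT.
- have subL d x : d \in [:: a; b] -> x \in lvars (d :: rem (NOr a b) S) ->
    x \in lvars S.
    rewrite !inE => dab; apply: lvars_sub => e; rewrite !inE.
    case/orP=> [/eqP->|/subR]; last exact: mem_lvars.
    move=> y ya; apply: (mem_lvars fS); rewrite /= mem_cat.
    by case/orP: dab ya => /eqP-> ->; rewrite ?orbT.
  have sat_side d : d \in [:: a; b] ->
    satisfiable ((d :: rem (NOr a b) S) ++ T) -> satisfiable (S ++ T).
    move=> dab [t]; rewrite cat_cons /= => /andP[td].
    rewrite all_cat => /andP[tr tT].
    exists t; rewrite all_cat satS tr tT /= !andbT.
    by move: dab td; rewrite !inE => /orP[] /eqP-> ->; rewrite ?orbT.
  have [||[c [vS vT cS cT]]] := IH (a :: rem (NOr a b) S).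
  + by rewrite sizeS /lsize /=; lia.
  + by left; apply: (@sat_side a); rewrite // inE eqxx.
  have [||[d [wS wT dS dT]]] := IH (b :: rem (NOr a b) S).
  + by rewrite sizeS /lsize /=; lia.
  + by left; apply: (@sat_side b); rewrite // !inE eqxx orbT.
  right; exists (NOr c d); split=> /=.
  + move=> x; rewrite mem_cat => /orP[/vS|/wS]; apply: subL;
    by rewrite !inE eqxx ?orbT.
  + by move=> x; rewrite mem_cat => /orP[/vT|/wT].
  + apply: (@Closed_and _ (ndual c) (ndual d)); first by rewrite inE eqxx.
    apply: (@Closed_or _ a b); first by rewrite !inE fS !orbT.
    * apply: closed_sub cS => x; rewrite !inE => /or3P[->|->|/subR ->];
      by rewrite ?orbT.
    * apply: closed_sub dS => x; rewrite !inE => /or3P[->|->|/subR ->];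
      by rewrite ?orbT.
  + apply: (@Closed_or _ c d); first by rewrite inE eqxx.
    * apply: closed_sub cT => x; rewrite !inE => /orP[->|->];
      by rewrite ?orbT.
    * apply: closed_sub dT => x; rewrite !inE => /orP[->|->];
      by rewrite ?orbT.
Qed.

(** [NDia a] with the boxes of [S] yields [NDia c], which contradicts the boxes of [T]. For a
    diamond on the right, [interpolantC] turns the result into a box. *)
Lemma interpolant_dia (S T : seq nnf) (a c : nnf) :
  NDia a \in S -> interpolant (a :: unbox S) (unbox T) c ->
  interpolant S T (NDia c).
Proof.
have subU (U : seq nnf) : {subset map NBox (unbox U) <= U}.
  by move=> x /mapP[d]; rewrite unboxP => ? ->.
have varU (U : seq nnf) : {subset lvars (unbox U) <= lvars U}.
  by apply: lvars_sub => d; rewrite unboxP => /mem_lvars.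
move=> aS [vS vT cS cT]; split=> /=.
- move=> x /vS /lvarsP[d]; rewrite inE => /orP[/eqP->|dS] xd.
    exact: (mem_lvars aS).
  by apply: varU; apply: (mem_lvars dS).
- by move=> x /vT /varU.
- apply: (@Closed_dia _ (ndual c :: unbox S) a); first by rewrite inE aS orbT.
    by rewrite /=; apply: sub_cons.
  by apply: closed_sub cS => x; rewrite !inE orbCA.
- apply: (@Closed_dia _ (unbox T) c) => //; first by rewrite inE eqxx.
  by move=> x /subU xT; rewrite inE xT orbT.
Qed.

(** Finite choice with an exit: either some diamond already provides an interpolant, or each has a
    witness. Every chosen tree is recorded as coming from some diamond, which is what makes the
    boxes true at the new root. *)
Lemma choose_children (P : Prop) (Q : nnf -> tree -> bool) (D : seq nnf) :
  (forall a : nnf, a \in D -> P \/ exists t, Q a t) ->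
  P \/ exists ts, (forall a : nnf, a \in D -> exists t, List.In t ts /\ Q a t) /\
                  (forall t, List.In t ts -> exists2 a, a \in D & Q a t).
Proof.
elim: D => [_|a D IH h]; first by right; exists [::].
have [|p|[t qt]] := h a; [by rewrite inE eqxx|by left|].
have [b bD|p|[ts [h1 h2]]] := IH; [|by left|].
  by apply: h; rewrite inE bD orbT.
right; exists (t :: ts); split=> [b|u].
  rewrite inE => /orP[/eqP->|/h1[u [ut qu]]]; first by exists t; split; [left|].
  by exists u; split; [right|].
case=> [<-|/h2[b bD qb]]; first by exists a; rewrite ?inE ?eqxx.
by exists b; rewrite ?inE ?bD ?orbT.
Qed.

(** If both literals lie in [S], falsum interpolates; if the clash crosses the partition, the
    literal in [S] does, its variable being common to both sides. *)
Lemma interpolant_clash (S T : seq nnf) (b : bool) (x : nat) :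
  NLit b x \in S -> NLit (~~ b) x \in S ++ T -> exists c, interpolant S T c.
Proof.
move=> bS; rewrite mem_cat => /orP[bS'|bT].
  exists (NConst false); split=> //; last exact: Closed_false.
  by apply: (@Closed_lit _ b x); rewrite inE /= ?bS ?bS'.
exists (NLit b x); split=> /=.
- by move=> y ?; apply: (mem_lvars bS).
- by move=> y ?; apply: (mem_lvars bT).
- by apply: (@Closed_lit _ b x); rewrite inE ?bS ?eqxx ?orbT.
- by apply: (@Closed_lit _ b x); rewrite inE ?bT ?eqxx ?orbT.
Qed.

Lemma decided_all (S T : seq nnf) : decided S T.
Proof.
have [n] := ubnP (lsize (S ++ T)); elim: n S T => // n IH S T.
rewrite ltnS lsize_cat => le_n.
have [cS|sS] := boolP (has is_compound S).
  by apply: decided_compound => // S' ?; apply: IH; rewrite lsize_cat; lia.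
have [cT|sT] := boolP (has is_compound T).
  apply/decidedC/decided_compound => // T' ?.
  by apply/decidedC/IH; rewrite lsize_cat; lia.
have [fS|nfS] := boolP (NConst false \in S).
  right; exists (NConst false); split=> //; last exact: Closed_false.
  by apply: Closed_false; rewrite inE fS orbT.
have [fT|nfT] := boolP (NConst false \in T).
  right; exists (NConst true); split=> //; first exact: Closed_false.
  by apply: Closed_false; rewrite inE fT orbT.
(* What a child witnessing [NDia a] must satisfy: [a] and the bodies of the boxes on both sides. *)
pose Q a t := sat a t && all (sat^~ t) (unbox (S ++ T)).
have unboxC U V : unbox (U ++ V) = unbox U ++ unbox V by exact: pmap_cat.
have [a|[c i]|[ts [tsD tsB]]] := @choose_children (exists c, interpolant S T c) Q
  (undia (S ++ T)); last 2 first.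
- by right; exists c.
(* Every diamond has a witness, so only a clash of literals can prevent a model. The label makes
   exactly the positive literals true. *)
- pose v := [seq x <- lvars (S ++ T) | NLit true x \in S ++ T].
  have [/hasP[x xv x0]|/hasPn noclash] :=
    boolP (has (fun x => NLit false x \in S ++ T) v).
    move: xv; rewrite mem_filter => /andP[x1 _].
    move: x1; rewrite mem_cat => /orP[x1|x1].
      by right; apply: (interpolant_clash x1).
    have [] := @interpolant_clash T S true x x1.
      by rewrite mem_cat orbC -mem_cat.
    by move=> c /interpolantC; right; exists (ndual c).
  left; exists (Node v ts); apply/allP => -[b|b x|a b|a b|a|a] aST.
  + case: b aST => //; rewrite mem_cat.
    by rewrite (negbTE nfS) (negbTE nfT).
  + have xl : x \in lvars (S ++ T).
      by apply: (mem_lvars aST); rewrite inE.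
    rewrite /= /v mem_filter; case: b aST => aST; first by rewrite aST xl.
    rewrite xl andbT eqbF_neg; apply/negP => xv; move: (noclash x).
    by rewrite /v mem_filter xv xl aST => /(_ isT).
  + by move: aST; rewrite mem_cat => /orP[aS|aT];
      [case/hasP: sS | case/hasP: sT]; exists (NAnd a b).
  + by move: aST; rewrite mem_cat => /orP[aS|aT];
      [case/hasP: sS | case/hasP: sT]; exists (NOr a b).
  + apply/sat_boxP => u /tsB[d _ /andP[_ /allP]]; apply.
    by rewrite unboxP.
  + apply/sat_diaP; have [|u [ut /andP[au _]]] := tsD a; last by exists u.
    by rewrite undiaP.
- rewrite undiaP mem_cat => /orP[aS|aT].
    have [|[t]|[c i]] := IH (a :: unbox S) (unbox T).
    + rewrite lsize_cat; have := lsize_undia aS; have := lsize_unbox T; lia.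
    + by rewrite cat_cons -unboxC; right; exists t.
    + by left; exists (NDia c); apply: interpolant_dia i.
  have [|[t]|[c i]] := IH (a :: unbox T) (unbox S).
  + rewrite lsize_cat; have := lsize_undia aT; have := lsize_unbox S; lia.
  + rewrite /= all_cat => /and3P[ta tT tS]; right; exists t.
    by rewrite /Q unboxC all_cat ta tS tT.
  + left; exists (ndual (NDia c)).
    exact: (interpolantC (interpolant_dia aT i)).
Qed.

Lemma nnf_interpolation (a b : nnf) :
  (forall t, sat a t -> sat b t) ->
  exists c, [/\ {subset nvars c <= nvars a}, {subset nvars c <= nvars b},
                closed [:: a; ndual c] & closed [:: c; ndual b]].
Proof.
move=> ab; have [[t /=]|[c [va vb ca cb]]] := decided_all [:: a] [:: ndual b].
  by rewrite sat_dual andbT => /andP[/ab ->].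
exists c; split=> //.
- by move=> x /va; rewrite /lvars /= cats0.
- by move=> x /vb; rewrite /lvars /= cats0 nvars_dual.
- by apply: closed_sub ca => x; rewrite !inE orbC.
Qed.

(** Through [ent_closed] this makes a formula and its dual contradictory in every calculus. *)
Lemma closed_dual (a : nnf) : closed [:: a; ndual a].
Proof.
elim: a => [b|b x|a IHa b IHb|a IHa b IHb|a IH|a IH] /=.
- by apply: Closed_false; case: b.
- by apply: (@Closed_lit _ b x); rewrite !inE eqxx ?orbT.
- apply: (@Closed_and _ a b); first by rewrite inE eqxx.
  apply: (@Closed_or _ (ndual a) (ndual b)); first by rewrite !inE eqxx !orbT.
    by apply: closed_sub IHa => x; rewrite !inE => /orP[]->; rewrite ?orbT.
  by apply: closed_sub IHb => x; rewrite !inE => /orP[]->; rewrite ?orbT.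
- apply: (@Closed_and _ (ndual a) (ndual b)); first by rewrite !inE eqxx orbT.
  apply: (@Closed_or _ a b); first by rewrite !inE eqxx !orbT.
    by apply: closed_sub IHa => x; rewrite !inE => /orP[]->; rewrite ?orbT.
  by apply: closed_sub IHb => x; rewrite !inE => /orP[]->; rewrite ?orbT.
- apply: (@Closed_dia _ [:: a] (ndual a)); first by rewrite !inE eqxx orbT.
    by move=> x; rewrite !inE => ->.
  by apply: closed_sub IH => x; rewrite !inE orbC.
- apply: (@Closed_dia _ [:: ndual a] a) => //; first by rewrite !inE eqxx.
  by move=> x; rewrite !inE => ->; rewrite orbT.
Qed.

(** * Team semantics through resolutions *)

Definition ands (A B : seq nnf) : seq nnf := [seq NAnd a b | a <- A, b <- B].
Definition tensors (A B : seq nnf) : seq nnf := [seq NOr a b | a <- A, b <- B].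

(* One element per function [F] from [A] to [B], namely the conjunction over
   [a] in [A] of the implications from [a] to [F a]. *)
Fixpoint imps (A B : seq nnf) : seq nnf :=
  if A is a :: A' then
    [seq NAnd (NOr (ndual a) b) c | b <- B, c <- imps A' B]
  else [:: NConst true].

(* The points are trees, each evaluated at its root. *)
Definition team := tree -> Prop.

Definition subteam (d e : team) : Prop := forall t, d t -> e t.

Definition successors (d : team) : team :=
  fun u => exists2 t, d t & List.In u (children t).

Definition supports (d : team) (A : seq nnf) : Prop :=
  exists2 a, a \in A & forall t, d t -> sat a t.

Lemma supports_sub (d e : team) (A : seq nnf) :
  subteam d e -> supports e A -> supports d A.
Proof. by move=> de [a aA ea]; exists a => // t /de /ea. Qed.

Lemma supports1 (d : team) (a : nnf) :
  supports d [:: a] <-> forall t, d t -> sat a t.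
Proof.
by split=> [[b]|da]; [rewrite inE => /eqP-> | exists a; rewrite ?inE].
Qed.

Lemma supports_ands (d : team) (A B : seq nnf) :
  supports d (ands A B) <-> supports d A /\ supports d B.
Proof.
split=> [[c /allpairsP[[a b] /= [aA bB ->]] h]|[[a aA da] [b bB db]]].
  by split; [exists a|exists b] => // t /h /andP[].
exists (NAnd a b) => [|t dt]; last by rewrite /= da ?db.
exact: allpairs_f.
Qed.

Lemma supports_cat (d : team) (A B : seq nnf) :
  supports d (A ++ B) <-> supports d A \/ supports d B.
Proof.
split=> [[a]|]; first by rewrite mem_cat => /orP[] ? ?; [left|right]; exists a.
by case=> -[a aA da]; exists a => //; rewrite mem_cat aA ?orbT.
Qed.

(** The two teams need only cover [d]. Since support is downward closed, intersecting them with [d]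
    recovers the usual clause with a union of subteams. *)
Lemma supports_tensors (d : team) (A B : seq nnf) :
  supports d (tensors A B) <->
  exists d1 d2, [/\ forall t, d t -> d1 t \/ d2 t, supports d1 A & supports d2 B].
Proof.
split=> [[c /allpairsP[[a b] /= [aA bB ->]] h]|[d1 [d2 [d12 [a aA da] [b bB db]]]]].
  exists (sat a), (sat b); split; [|by exists a|by exists b].
  by move=> t /h /orP.
exists (NOr a b) => [|t /d12[/da|/db]] /=; last 2 first.
- by move=> ->.
- by move=> ->; rewrite orbT.
exact: allpairs_f.
Qed.

(** For a single [a] in [A], the subteams of [d] supporting [a] have a largest one, the points of
    [d] satisfying [a]. The element of [B] supported there is the value at [a] of the function that
    the resolution encodes. *)
Lemma supports_imps (d : team) (A B : seq nnf) :
  supports d (imps A B) <->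
  forall e, subteam e d -> supports e A -> supports e B.
Proof.
split=> [[c cI dc] e ed [a aA ea]|].
  elim: A c cI dc aA => //= a' A IH _ /allpairsP[[b c] /= [bB cI ->]] dc.
  rewrite inE => /orP[/eqP aa'|aA].
    exists b => // t et; have := dc _ (ed _ et).
    by rewrite /= sat_dual -aa' (ea _ et) => /andP[].
  by apply: IH cI _ aA => t /dc /andP[].
elim: A => [_|a A IH h]; first by exists (NConst true).
have [b bB eb] : supports (fun t => d t /\ sat a t) B.
  by apply: h => [t []//|]; exists a; rewrite ?inE ?eqxx // => t [].
have [c cI dc] : supports d (imps A B).
  apply: IH => e ed [a' aA ea]; apply: h => //; exists a' => //.
  by rewrite inE aA orbT.
exists (NAnd (NOr (ndual a) b) c); first exact: allpairs_f.
move=> t dt /=; rewrite dc // andbT sat_dual; case: (boolP (sat a t)) => //= ta.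
exact: eb.
Qed.

Lemma supports_box (d : team) (A : seq nnf) :
  supports d (map NBox A) <-> supports (successors d) A.
Proof.
split=> [[c /mapP[a aA ->] h]|[a aA h]].
  by exists a => // u [t /h /sat_boxP]; apply.
exists (NBox a); first exact: map_f.
by move=> t dt; apply/sat_boxP => u ut; apply: h; exists t.
Qed.

(** [e] may contain points that succeed nothing in [d]; downward closure allows discarding them
    where this matters. *)
Lemma supports_dia (d : team) (A : seq nnf) :
  supports d (map NDia A) <->
  exists2 e : team, supports e A &
    forall t, d t -> exists2 u, List.In u (children t) & e u.
Proof.
split=> [[c /mapP[a aA ->] h]|[e [a aA ea] h]].
  exists (sat a); first by exists a.
  by move=> t /h /sat_diaP[u [ut au]]; exists u.
exists (NDia a); first exact: map_f.
by move=> t /h[u ut /ea au]; apply/sat_diaP; exists u.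
Qed.

Lemma supports_false (d : team) :
  supports d [:: NConst false] <-> forall t, ~ d t.
Proof.
by split=> [/supports1 h t /h|h]; last by apply/supports1 => t /h.
Qed.

(** * Calculi with a copy of the modal formulas *)

(* What the three systems have in common: [emb] embeds modal formulas as
   classical formulas, and [cneg a] is the negation of [emb a]. *)
Record calculus : Type := Calculus {
  fm : Type;
  fmvars : fm -> seq nat;
  ent : seq fm -> fm -> Prop;
  cbot : fm;
  cand : fm -> fm -> fm;
  cor : fm -> fm -> fm;
  cbox : fm -> fm;
  cdia : fm -> fm;
  emb : nnf -> fm;
  cneg : nnf -> fm;
  fmvars_bot : fmvars cbot = [::];
  fmvars_and f g : fmvars (cand f g) = fmvars f ++ fmvars g;
  fmvars_or f g : fmvars (cor f g) = fmvars f ++ fmvars g;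
  fmvars_box f : fmvars (cbox f) = fmvars f;
  fmvars_dia f : fmvars (cdia f) = fmvars f;
  fmvars_emb a : {subset fmvars (emb a) <= nvars a};
  ent_hyp G f : List.In f G -> ent G f;
  ent_subst G H f : (forall g, List.In g G -> ent H g) -> ent G f -> ent H f;
  ent_botE G f : ent G cbot -> ent G f;
  ent_andI G f g : ent G f -> ent G g -> ent G (cand f g);
  ent_andE1 G f g : ent G (cand f g) -> ent G f;
  ent_andE2 G f g : ent G (cand f g) -> ent G g;
  ent_orI1 G f g : ent G f -> ent G (cor f g);
  ent_orI2 G f g : ent G g -> ent G (cor f g);
  ent_orE G f g k :
    ent G (cor f g) -> ent (f :: G) k -> ent (g :: G) k -> ent G k;
  ent_box G f : ent G f -> ent (map cbox G) (cbox f);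
  ent_dia f g : ent [:: f] g -> ent [:: cdia f] (cdia g);
  ent_box_or f g : ent [:: cbox (cor f g)] (cor (cbox f) (cbox g));
  ent_dia_or f g : ent [:: cdia (cor f g)] (cor (cdia f) (cdia g));
  emb_false : emb (NConst false) = cbot;
  emb_and a b : emb (NAnd a b) = cand (emb a) (emb b);
  emb_box a : emb (NBox a) = cbox (emb a);
  emb_dia a : emb (NDia a) = cdia (emb a);
  ent_true G : ent G (emb (NConst true));
  ent_clash b x : ent [:: emb (NLit b x); emb (NLit (~~ b) x)] cbot;
  ent_lit b x : ent [:: cneg (NLit b x)] (emb (NLit (~~ b) x));
  ent_negI G a : ent (emb a :: G) cbot -> ent G (cneg a);
  ent_negE a : ent [:: emb a; cneg a] cbot;
  ent_raa G a : ent (cneg a :: G) cbot -> ent G (emb a);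
  ent_norI1 a b : ent [:: emb a] (emb (NOr a b));
  ent_norI2 a b : ent [:: emb b] (emb (NOr a b));
  ent_norE G a b : ent G (emb (NOr a b)) ->
    ent (emb a :: G) cbot -> ent (emb b :: G) cbot -> ent G cbot;
  ent_neg_box a : ent [:: cneg (NBox a)] (cdia (cneg a));
  ent_neg_dia a : ent [:: cneg (NDia a)] (cbox (cneg a));
  ent_dia_neg a : ent [:: emb (NDia a); cbox (cneg a)] cbot
}.

Section Calculus.
Variable C : calculus.
Implicit Types (f g k : fm C) (G H : seq (fm C)) (a b c : nnf).

Lemma ent_weak G H f : (forall g, List.In g G -> List.In g H) ->
  ent G f -> ent H f.
Proof. by move=> GH; apply: ent_subst => g /GH; apply: ent_hyp. Qed.

Lemma ent_consW G f g : ent G f -> ent (g :: G) f.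
Proof. by apply: ent_weak => k; right. Qed.

Lemma ent_head G f : ent (f :: G) f.
Proof. by apply: ent_hyp; left. Qed.

Lemma ent_cut G f g : ent G f -> ent (f :: G) g -> ent G g.
Proof.
by move=> Gf; apply: ent_subst => k [<-//|]; apply: ent_hyp.
Qed.

Lemma ent1 G f g : ent [:: f] g -> ent G f -> ent G g.
Proof. by move=> fg Gf; apply: ent_subst fg => k [<-|[]]. Qed.

Lemma ent2 G f g k : ent [:: f; g] k -> ent G f -> ent G g -> ent G k.
Proof. by move=> fg Gf Gg; apply: ent_subst fg => l [<-|[<-|[]]]. Qed.

Lemma in_map_emb (S : seq nnf) a : a \in S -> List.In (emb C a) (map (emb C) S).
Proof.
elim: S => //= b S IH; rewrite inE => /orP[/eqP->|/IH]; first by left.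
by right.
Qed.

(** Each tableau rule is a derivable refutation step. In the modal case the refutation of [a :: T]
    becomes a derivation of [cneg C a] from [T]; boxing it contradicts [NDia a]. *)
Lemma ent_closed (S : seq nnf) : closed S -> ent (map (emb C) S) (cbot C).
Proof.
elim=> {S} [S h|S b x h1 h2|S a b h _ IH|S a b h _ IHa _ IHb|S T a h sT _ IH].
- by rewrite -emb_false; apply/ent_hyp/in_map_emb.
- by apply: (ent2 (ent_clash C b x)); apply/ent_hyp/in_map_emb.
- have Gab : ent (map (emb C) S) (cand (emb C a) (emb C b)).
    by rewrite -emb_and; apply/ent_hyp/in_map_emb.
  apply: (ent_cut (ent_andE2 Gab)); apply: ent_cut IH.
  exact/ent_consW/(ent_andE1 Gab).
- exact: ent_norE (ent_hyp (in_map_emb h)) IHa IHb.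
- have TB : ent (map (emb C) S) (cbox (cneg C a)).
    apply: ent_subst (ent_box (ent_negI IH)) => g; rewrite -map_comp.
    elim: T sT {IH} => //= c T IHT sT [<-|/IHT].
      by rewrite -emb_box; apply/ent_hyp/in_map_emb/sT; rewrite inE eqxx.
    by apply=> x xT; apply: sT; rewrite inE xT orbT.
  by apply: (ent2 (ent_dia_neg C a)) => //; apply/ent_hyp/in_map_emb.
Qed.

Lemma ent_dual_negE a : ent [:: emb C a; emb C (ndual a)] (cbot C).
Proof. exact: ent_closed (closed_dual a). Qed.

(** Reductio introduces [cneg C a], which need not be the embedding of a modal formula, whereas
    tableaux only see embeddings. Pushing the negation inwards bridges the two. *)
Lemma ent_neg_dual a : ent [:: cneg C a] (emb C (ndual a)).
Proof.
elim: a => [[]|b x|a IHa b IHb|a IHa b IHb|a IH|a IH] /=.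
- rewrite emb_false; apply: (ent2 (ent_negE C (NConst true))).
    exact: ent_true.
  exact: ent_head.
- exact: ent_true.
- exact: ent_lit.
- apply: ent_raa; apply: (ent2 (ent_negE C (NAnd a b))); last first.
    by apply: ent_hyp; right; left.
  rewrite emb_and; apply: ent_andI; apply: ent_raa;
    apply: (ent2 (ent_negE C (NOr (ndual a) (ndual b)))).
  + by apply: (ent1 (ent_norI1 _ _ _)); apply: ent1 IHa _; apply: ent_head.
  + by apply: ent_hyp; right; left.
  + by apply: (ent1 (ent_norI2 _ _ _)); apply: ent1 IHb _; apply: ent_head.
  + by apply: ent_hyp; right; left.
- rewrite emb_and; apply: ent_andI.
    apply: ent1 IHa _; apply: ent_negI.
    apply: (ent2 (ent_negE C (NOr a b))); last by apply: ent_hyp; right; left.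
    by apply: (ent1 (ent_norI1 _ _ _)); apply: ent_head.
  apply: ent1 IHb _; apply: ent_negI.
  apply: (ent2 (ent_negE C (NOr a b))); last by apply: ent_hyp; right; left.
  by apply: (ent1 (ent_norI2 _ _ _)); apply: ent_head.
- by rewrite emb_dia; apply: ent1 (ent_dia IH) _; apply: ent_neg_box.
- by rewrite emb_box; apply: ent1 (ent_box IH) _; apply: ent_neg_dia.
Qed.

Lemma ent_closed_dual a b : closed [:: a; ndual b] -> ent [:: emb C a] (emb C b).
Proof.
move=> /ent_closed ab; apply: ent_raa; apply: ent_subst ab => g [<-|[<-|[]]].
  by apply: ent_hyp; right; left.
by apply: (ent1 (ent_neg_dual _)); apply: ent_head.
Qed.

(** * Disjunctive normal forms *)

Fixpoint cors (A : seq nnf) : fm C :=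
  if A is a :: A' then cor (emb C a) (cors A') else cbot C.

Lemma ent_cors G (A : seq nnf) a : a \in A -> ent G (emb C a) -> ent G (cors A).
Proof.
elim: A => //= b A IH; rewrite inE => /orP[/eqP->|/IH h] Ga.
  exact: ent_orI1.
exact/ent_orI2/h.
Qed.

(** Case analysis below an operator. The list ends in [op (cbot C)], which need not be
    contradictory, for instance when [op] is a box. As [A] is nonempty, monotonicity reduces this
    case to that of a member of [A]. *)
Lemma ent_cors_under (op : fm C -> fm C) (A : seq nnf) G k :
  (forall f g, ent [:: f] g -> ent [:: op f] (op g)) ->
  (forall f g, ent [:: op (cor f g)] (cor (op f) (op g))) ->
  A != [::] -> ent G (op (cors A)) ->
  (forall a, a \in A -> ent (op (emb C a) :: G) k) -> ent G k.
Proof.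
move=> mono distr A0 GA Ak.
have : ent (op (cbot C) :: G) k.
  case: A A0 {GA} Ak => // a A _ /(_ a (mem_head _ _)) h.
  apply: ent_subst h => g [<-|gG]; last by apply: ent_hyp; right.
  apply: (ent1 (mono (cbot C) _ _)); last exact: ent_head.
  exact/ent_botE/ent_head.
elim: A G Ak GA {A0} => /= [|a A IH] G Ak GA bk; first exact: ent_cut GA bk.
apply: (ent_orE (ent1 (distr _ _) GA)); first by apply: Ak; rewrite inE eqxx.
apply: IH; last 2 first.
- exact: ent_head.
- by apply: ent_weak bk => g [<-|gG]; [left|right; right].
move=> b bA; have bk' := Ak b; apply: ent_weak (bk' _).
  by move=> g [<-|gG]; [left|right; right].
by rewrite inE bA orbT.
Qed.

Definition normal_form f (A : seq nnf) : Prop :=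
  [/\ A != [::], forall a, a \in A -> {subset nvars a <= fmvars f},
      ent [:: f] (cors A) & forall a, a \in A -> ent [:: emb C a] f].

Lemma normal_formE (op : fm C -> fm C) f (A : seq nnf) G k :
  (forall f g, ent [:: f] g -> ent [:: op f] (op g)) ->
  (forall f g, ent [:: op (cor f g)] (cor (op f) (op g))) ->
  normal_form f A -> ent G (op f) ->
  (forall a, a \in A -> ent (op (emb C a) :: G) k) -> ent G k.
Proof.
move=> mono distr [A0 _ fA _] Gf; apply: (ent_cors_under mono distr A0).
exact: ent1 (mono _ _ fA) Gf.
Qed.

Lemma normal_form_id f (A : seq nnf) G k :
  normal_form f A -> ent G f ->
  (forall a, a \in A -> ent (emb C a :: G) k) -> ent G k.
Proof. by apply: (@normal_formE id) => // f' g'; apply: ent_head. Qed.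

Lemma normal_form_emb a f :
  {subset nvars a <= fmvars f} -> ent [:: f] (emb C a) ->
  ent [:: emb C a] f -> normal_form f [:: a].
Proof.
move=> va fa af; split=> //; try by move=> b; rewrite inE => /eqP->.
exact: ent_orI1.
Qed.

Lemma normal_form_equiv f g (A : seq nnf) :
  {subset fmvars g <= fmvars f} -> ent [:: f] g -> ent [:: g] f ->
  normal_form g A -> normal_form f A.
Proof.
move=> vgf fg gf [A0 vA gA Ag]; split=> //.
- by move=> a /vA va x /va /vgf.
- exact: ent1 gA fg.
- by move=> a /Ag ag; apply: ent1 gf ag.
Qed.

Lemma pairs_neq0 (F : nnf -> nnf -> nnf) (A B : seq nnf) :
  A != [::] -> B != [::] -> [seq F a b | a <- A, b <- B] != [::].
Proof. by case: A B => [|a A] [|b B]. Qed.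

Lemma normal_form_and f g (A B : seq nnf) :
  normal_form f A -> normal_form g B -> normal_form (cand f g) (ands A B).
Proof.
move=> nA nB; have [A0 vA _ Af] := nA; have [B0 vB _ Bg] := nB; split.
- exact: pairs_neq0.
- move=> c /allpairsP[[a b] /= [/vA va /vB vb ->]] x.
  by rewrite /= fmvars_and !mem_cat => /orP[/va|/vb] ->; rewrite ?orbT.
- apply: (normal_form_id nA (ent_andE1 (ent_head _ _))) => a aA.
  apply: (normal_form_id nB) => [|b bB].
    by apply: ent_andE2; apply: ent_consW; apply: ent_head.
  apply: (@ent_cors _ _ (NAnd a b)); first exact: allpairs_f.
  by rewrite emb_and; apply: ent_andI; [apply: ent_consW|]; apply: ent_head.
- move=> c /allpairsP[[a b] /= [/Af af /Bg bg ->]]; rewrite emb_and.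
  apply: ent_andI; first exact: ent1 af (ent_andE1 (ent_head _ _)).
  exact: ent1 bg (ent_andE2 (ent_head _ _)).
Qed.

Lemma normal_form_or f g (A B : seq nnf) :
  normal_form f A -> normal_form g B -> normal_form (cor f g) (A ++ B).
Proof.
move=> nA nB; have [A0 vA _ Af] := nA; have [B0 vB _ Bg] := nB; split.
- by case: A A0 {nA vA Af}.
- move=> c; rewrite mem_cat fmvars_or => /orP[/vA|/vB] v x /v;
  by rewrite mem_cat => ->; rewrite ?orbT.
- apply: (ent_orE (ent_head _ _)).
    apply: (normal_form_id nA (ent_head _ _)) => a aA.
    by apply: (@ent_cors _ _ a); rewrite ?mem_cat ?aA //; apply: ent_head.
  apply: (normal_form_id nB (ent_head _ _)) => b bB.
  by apply: (@ent_cors _ _ b); rewrite ?mem_cat ?bB ?orbT //; apply: ent_head.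
- move=> c; rewrite mem_cat => /orP[/Af|/Bg] h.
    exact: ent_orI1.
  exact: ent_orI2.
Qed.

Lemma ent_box1 f g : ent [:: f] g -> ent [:: cbox f] (cbox g).
Proof. exact: ent_box. Qed.

Lemma normal_form_box f (A : seq nnf) :
  normal_form f A -> normal_form (cbox f) (map NBox A).
Proof.
move=> nA; have [A0 vA _ Af] := nA; split.
- by case: A A0 {nA vA Af}.
- by move=> c /mapP[a /vA va ->]; rewrite fmvars_box.
- apply: (normal_formE ent_box1 (@ent_box_or C) nA (ent_head _ _)) => a aA.
  apply: (@ent_cors _ _ (NBox a)); first exact: map_f.
  by rewrite emb_box; apply: ent_head.
- by move=> c /mapP[a /Af af ->]; rewrite emb_box; apply: ent_box1.
Qed.

Lemma normal_form_dia f (A : seq nnf) :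
  normal_form f A -> normal_form (cdia f) (map NDia A).
Proof.
move=> nA; have [A0 vA _ Af] := nA; split.
- by case: A A0 {nA vA Af}.
- by move=> c /mapP[a /vA va ->]; rewrite fmvars_dia.
- apply: (normal_formE (@ent_dia C) (@ent_dia_or C) nA (ent_head _ _)) => a aA.
  apply: (@ent_cors _ _ (NDia a)); first exact: map_f.
  by rewrite emb_dia; apply: ent_head.
- by move=> c /mapP[a /Af af ->]; rewrite emb_dia; apply: ent_dia.
Qed.

(** The tensor is a parameter because MID lacks it. It distributes over disjunctions in its right
    factor; commutativity carries this over to the left one. *)
Lemma normal_form_tensor (ten : fm C -> fm C -> fm C) f g (A B : seq nnf) :
  (forall f g, fmvars (ten f g) = fmvars f ++ fmvars g) ->
  (forall f g h k, ent [:: f] h -> ent [:: g] k ->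
     ent [:: ten f g] (ten h k)) ->
  (forall f g h, ent [:: ten f (cor g h)] (cor (ten f g) (ten f h))) ->
  (forall f g, ent [:: ten f g] (ten g f)) ->
  (forall a b, ent [:: ten (emb C a) (emb C b)] (emb C (NOr a b))) ->
  (forall a b, ent [:: emb C (NOr a b)] (ten (emb C a) (emb C b))) ->
  normal_form f A -> normal_form g B -> normal_form (ten f g) (tensors A B).
Proof.
move=> vten mono distr tenC tenE tenI nA nB.
have [A0 vA _ Af] := nA; have [B0 vB _ Bg] := nB; split.
- exact: pairs_neq0.
- move=> c /allpairsP[[a b] /= [/vA va /vB vb ->]] x.
  by rewrite /= vten !mem_cat => /orP[/va|/vb] ->; rewrite ?orbT.
- apply: (normal_formE (op := ten f) _ (distr f) nB (ent_head _ _)) => [h k hk|b bB].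
    by apply: mono => //; apply: ent_head.
  apply: (normal_formE (op := ten^~ (emb C b)) _ _ nA (ent_head _ _)) => [h k hk|h k|a aA].
  + by apply: mono => //; apply: ent_head.
  + apply: (ent_orE (ent1 (distr _ _ _) (tenC _ _))).
      exact: ent_orI1 (ent1 (tenC _ _) (ent_head _ _)).
    exact: ent_orI2 (ent1 (tenC _ _) (ent_head _ _)).
  apply: (@ent_cors _ _ (NOr a b)); first exact: allpairs_f.
  exact: ent1 (tenE _ _) (ent_head _ _).
- move=> c /allpairsP[[a b] /= [/Af af /Bg bg ->]].
  exact: ent1 (mono _ _ _ _ af bg) (tenI _ _).
Qed.

Lemma fmvars_cors (A : seq nnf) (s : seq nat) :
  (forall a, a \in A -> {subset nvars a <= s}) -> {subset fmvars (cors A) <= s}.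
Proof.
elim: A => [|a A IH] vA /=; first by rewrite fmvars_bot.
move=> x; rewrite fmvars_or mem_cat => /orP[/fmvars_emb|].
  by apply: vA; rewrite inE eqxx.
by apply: IH => b bA; apply: vA; rewrite inE bA orbT.
Qed.

Theorem calculus_interpolation f g (A B : seq nnf) (q : seq nat) :
  normal_form f A -> normal_form g B ->
  (forall x, x \in fmvars f -> x \in fmvars g -> x \in q) ->
  (forall d, supports d A -> supports d B) ->
  exists theta, [/\ {subset fmvars theta <= q}, ent [:: f] theta &
                    ent [:: theta] g].
Proof.
move=> nA nB fgq AB; have [_ vA _ _] := nA; have [_ vB _ Bg] := nB.
suff [S [vS AS Sg]] : exists S, [/\ forall c, c \in S -> {subset nvars c <= q},
    forall a, a \in A -> ent [:: emb C a] (cors S) &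
    forall c, c \in S -> ent [:: emb C c] g].
  exists (cors S); split; first exact: fmvars_cors.
    apply: (normal_form_id nA (ent_head _ _)) => a aA.
    exact: ent1 (AS a aA) (ent_head _ _).
  elim: S Sg {vS AS} => [_|c S IH Sg] /=; first exact: ent_botE (ent_head _ _).
  apply: (ent_orE (ent_head _ _)).
    by apply: ent1 (Sg c _) (ent_head _ _); rewrite inE eqxx.
  apply: ent1 (IH _) (ent_head _ _) => d dS; apply: Sg.
  by rewrite inE dS orbT.
have {AB} : forall a, a \in A -> exists2 b, b \in B & forall t, sat a t -> sat b t.
  by move=> a aA; apply: AB; exists a.
elim: A vA {nA} => [_ _|a A IH vA AB]; first by exists [::].
have [||S [vS AS Sg]] := IH.
- by move=> b bA; apply: vA; rewrite inE bA orbT.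
- by move=> b bA; apply: AB; rewrite inE bA orbT.
have [b bB ab] := AB a (mem_head _ _).
have [c [va vb ac cb]] := nnf_interpolation ab.
exists (c :: S); split=> [d|d|d]; rewrite inE => /orP[/eqP->|dS].
- move=> x xc; apply: fgq; first exact: vA (mem_head _ _) _ (va _ xc).
  exact: vB bB _ (vb _ xc).
- exact: vS.
- exact: ent_orI1 (ent_closed_dual ac).
- exact: ent_orI2 (AS _ dS).
- exact: ent1 (Bg b bB) (ent_closed_dual cb).
- exact: Sg.
Qed.

End Calculus.

(** * MT0 and MID *)

(* [D] gives the resolutions of the dependence atoms. *)
Fixpoint hresolutions_with (t : bool) (D : seq (hcform t) -> hcform t -> seq nnf)
    (f : hform t) : seq nnf :=
  match f with
  | HVar x => [:: NLit true x]
  | HBot => [:: NConst false]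
  | HDep s b => D s b
  | HAnd f g => ands (hresolutions_with D f) (hresolutions_with D g)
  | HTens _ f g => tensors (hresolutions_with D f) (hresolutions_with D g)
  | HOr f g => hresolutions_with D f ++ hresolutions_with D g
  | HImp f g => imps (hresolutions_with D f) (hresolutions_with D g)
  | HBox f => map NBox (hresolutions_with D f)
  | HDia f => map NDia (hresolutions_with D f)
  end.

(** The unfolding of a dependence atom is not a subformula, so plain structural induction does not
    reach it. Assuming a claim only at the atoms that occur splits the argument: it holds outright
    for the unfoldings, which contain no atoms, and then for all formulas. *)
Fixpoint hdeps (t : bool) (P : seq (hcform t) -> hcform t -> Prop)
    (f : hform t) : Prop :=
  match f with
  | HVar _ | HBot => True
  | HDep s b => P s b
  | HAnd f g | HTens _ f g | HOr f g | HImp f g => hdeps P f /\ hdeps P g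
  | HBox f | HDia f => hdeps P f
  end.

(* Unfolding a dependence atom yields a formula without dependence atoms, so
   the inner choice of resolutions for them is irrelevant. *)
Definition hresolutions (t : bool) : hform t -> seq nnf :=
  hresolutions_with (fun s b => hresolutions_with (fun _ _ => [::]) (hdep_def s b)).

Lemma hdeps_all (t : bool) (P : seq (hcform t) -> hcform t -> Prop) (f : hform t) :
  (forall s b, P s b) -> hdeps P f.
Proof. by move=> allP; elim: f => /=. Qed.

Lemma hdeps_classical (t : bool) P (a : hcform t) : hdeps P a.
Proof. by elim: a => /=. Qed.

Lemma hdeps_dep_def (t : bool) P (s : seq (hcform t)) (b : hcform t) :
  hdeps P (hdep_def s b).
Proof.
have em (c : hcform t) : hdeps P (hem c) by do !split; exact: hdeps_classical.
case: s => [|a s]; first exact: em.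
split; last exact: em.
elim: s (hem a) (em a) => //= c s IH f hf.
by split=> //; apply: IH.
Qed.

Lemma hresolutions_with_eq (t : bool) D D' (f : hform t) :
  hdeps (fun s b => D s b = D' s b) f ->
  hresolutions_with D f = hresolutions_with D' f.
Proof.
elim: f => //= [f IHf g IHg|h f IHf g IHg|f IHf g IHg|f IHf g IHg|f IH|f IH];
by move=> [] * || move=> *; rewrite ?IHf ?IHg ?IH.
Qed.

Lemma hresolutions_dep (t : bool) (s : seq (hcform t)) (b : hcform t) :
  hresolutions (HDep s b) = hresolutions (hdep_def s b).
Proof.
by rewrite /hresolutions /=; apply: hresolutions_with_eq; exact: hdeps_dep_def.
Qed.

Lemma hresolutions_classical (t : bool) (a : hcform t) :
  exists c, hresolutions a = [:: c].
Proof.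
rewrite /hresolutions.
elim: a => /= [x||a [c ->] b [d ->]|h a [c ->] b [d ->]|a [c ->] b [d ->]|a [c ->]|a [c ->]];
by eexists.
Qed.

Section Hilbert.
Variable t : bool.
Implicit Types (f g k l : hform t) (a : hcform t) (G H : seq (hform t)) (d e : team).

(** Deduction theorem. Necessitation does not obstruct it: its premise has no hypotheses, so its
    conclusion is a theorem and [HA_K] applies. *)
Lemma hder_imp G f g : hder (f :: G) g -> hder G (HImp f g).
Proof.
move: {1 3}(f :: G) (erefl (f :: G)) => H eH dH.
elim: dH eH => {H g} [H g Hg|H g ag|H g k _ IH1 _ IH2|H g dg _] eH; subst H.
- case: Hg => [<-|Gg]; last first.
    by apply: HD_mp (HD_ax _ (HA_K _ _)) _; apply: HD_hyp.
  apply: HD_mp (HD_ax _ (HA_K f f)).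
  by apply: HD_mp (HD_ax _ (HA_S f (HImp f f) f)) (HD_ax _ (HA_K _ _)).
- by apply: HD_mp (HD_ax _ (HA_K _ _)) _; apply: HD_ax.
- apply: HD_mp (IH2 erefl); apply: HD_mp (IH1 erefl).
  exact: HD_ax (HA_S _ _ _).
- by apply: HD_mp (HD_ax _ (HA_K _ _)) _; apply: HD_nec.
Qed.

Lemma hder_subst G H f :
  (forall g, List.In g G -> hder H g) -> hder G f -> hder H f.
Proof.
move=> GH dG; elim: dG GH => {G f} [G f Gf|G f af|G f g _ IH1 _ IH2|G f df _] GH.
- exact: GH.
- exact: HD_ax.
- exact: HD_mp (IH1 GH) (IH2 GH).
- exact: HD_nec.
Qed.

Lemma hder_ax1 G f g : haxiom (HImp f g) -> hder G f -> hder G g.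
Proof. by move/(HD_ax G)/HD_mp; apply. Qed.

Lemma hder_ax2 G f g k :
  haxiom (HImp f (HImp g k)) -> hder G f -> hder G g -> hder G k.
Proof. by move/hder_ax1 => h /h /HD_mp; apply. Qed.

Lemma hder_head G f : hder (f :: G) f.
Proof. by apply: HD_hyp; left. Qed.

Lemma hder_consW G f g : hder G f -> hder (g :: G) f.
Proof. by apply: hder_subst => k Gk; apply: HD_hyp; right. Qed.

Lemma hder_nec_imp G f g : hder [:: f] g -> hder G (HBox (HImp f g)).
Proof. by move/hder_imp => h; apply: HD_nec. Qed.

(** [NOr] becomes an implication so that one embedding serves both values of [t]. Where the tensor
    exists, it is interderivable with this implication on embedded formulas, as checked in
    [hnormal_form_with]. *)
Fixpoint hemb (a : nnf) : hcform t :=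
  match a with
  | NConst b => if b then HCImp HCBot HCBot else HCBot
  | NLit b x => if b then HCVar t x else HCImp (HCVar t x) HCBot
  | NAnd a b => HCAnd (hemb a) (hemb b)
  | NOr a b => HCImp (HCImp (hemb a) HCBot) (hemb b)
  | NBox a => HCBox (hemb a)
  | NDia a => HCDia (hemb a)
  end.

Lemma hder_raa G (a : hcform t) : hder (HImp a HBot :: G) HBot -> hder G a.
Proof. by move/hder_imp; apply: hder_ax1; apply: HA_dne. Qed.

Lemma hder_imp_subst G f g : hder [:: f] g -> hder G f -> hder G g.
Proof. by move=> fg Gf; apply: hder_subst fg => k [<-|[]]. Qed.

Definition hilbert : calculus.
Proof.
refine (@Calculus (hform t) (@hvars t) (@hder t) HBot (@HAnd t) (@HOr t)
  (@HBox t) (@HDia t) (fun a : nnf => hclassical (hemb a))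
  (fun a : nnf => HImp (hclassical (hemb a)) HBot)
  _ _ _ _ _ _ _ _ _ _ _ _ _ _ _ _ _ _ _ _ _ _ _ _ _ _ _ _ _ _ _ _ _ _ _) => //.
- elim=> //= [[]|[] x|a IHa b IHb|a IHa b IHb] //= x;
  by rewrite ?cats0 !mem_cat => /orP[/IHa|/IHb] ->; rewrite ?orbT.
- by move=> G f; apply: HD_hyp.
- exact: hder_subst.
- by move=> G f; apply: hder_ax1; apply: HA_bot.
- by move=> G f g; apply: hder_ax2; apply: HA_and.
- by move=> G f g; apply: hder_ax1; apply: HA_and1.
- by move=> G f g; apply: hder_ax1; apply: HA_and2.
- by move=> G f g; apply: hder_ax1; apply: HA_or1.
- by move=> G f g; apply: hder_ax1; apply: HA_or2.
- move=> G f g k Gfg /hder_imp fk /hder_imp gk.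
  exact: HD_mp (hder_ax2 (HA_or f g k) fk gk) Gfg.
- elim=> [|g G IH] f /=; first exact: HD_nec.
  move=> /hder_imp /IH h.
  apply: (HD_mp _ (hder_head _ (HBox g))).
  by apply: hder_consW; apply: hder_ax1 h; apply: HA_boxK.
- move=> f g fg; apply: (hder_ax2 (HA_diaK f g)); last exact: hder_head.
  exact: hder_nec_imp.
- by move=> f g; apply: hder_ax1 (HA_boxor _ _) (hder_head _ _).
- by move=> f g; apply: hder_ax1 (HA_diaor _ _) (hder_head _ _).
- by move=> G; apply: hder_imp; apply: hder_head.
- move=> [] x.
    by apply: (HD_mp _ (hder_head _ _)); apply: HD_hyp; right; left.
  by apply: (HD_mp (hder_head _ _)); apply: HD_hyp; right; left.
- move=> [] x; first exact: hder_head.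
  exact: (@hder_ax1 _ _ _ (HA_dne (HCVar t x)) (hder_head _ _)).
- by move=> G a /hder_imp.
- move=> a.
  by apply: (HD_mp _ (hder_head _ _)); apply: HD_hyp; right; left.
- by move=> G a; apply: hder_raa.
- move=> a b; apply: hder_imp; apply: (hder_ax1 (HA_bot _)).
  by apply: (HD_mp (hder_head _ _)); apply: HD_hyp; right; left.
- by move=> a b; apply: hder_imp; apply: HD_hyp; right; left.
- move=> G a b Gab /hder_imp ha /hder_imp hb.
  exact: HD_mp hb (HD_mp Gab ha).
- by move=> a; apply: hder_ax1 (HA_nbox _) (hder_head _ _).
(* With falsum as the boxed formula, the axiom reduces the goal to [HBox HBot] under the assumption
   of a diamond that is already refuted. *)
- move=> a; apply: hder_ax1 (HA_diabox _ _) _; apply: hder_imp.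
  apply: (hder_ax1 (HA_bot _)).
  by apply: (HD_mp _ (hder_head _ _)); apply: HD_hyp; right; left.
- move=> a; apply: (@hder_ax1 _ (HDia HBot)); first exact: HA_diabot.
  apply: (@hder_ax2 _ _ (HDia (hemb a)) _ (HA_diaK _ _)); last exact: hder_head.
  by apply: HD_hyp; right; left.
Defined.

(** As [a] is classical, [HA_split] turns [a -> g] into a disjunction of the formulas [a -> b] with
    [b] in [B]. Doing this for each [a] in [A] selects a function from [A] to [B], that is, an
    element of [imps A B]. *)
Lemma hnormal_form_imp f g (A B : seq nnf) :
  @normal_form hilbert f A -> @normal_form hilbert g B ->
  @normal_form hilbert (HImp f g) (imps A B).
Proof.
move=> nA nB; have [A0 vA fA Af] := nA; have [B0 vB gB Bg] := nB; split.
- by elim: A {nA A0 vA fA Af} => //= a A; apply: pairs_neq0.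
- move=> c; elim: A vA {nA A0 fA Af} c => [_ c|a A IH vA c] /=.
    by rewrite inE => /eqP->.
  move=> /allpairsP[[b c'] /= [/vB vb cI ->]] x.
  rewrite /= nvars_dual !mem_cat -orbA => /or3P[xa|xb|xc].
  + by rewrite (vA a (mem_head _ _) _ xa).
  + by rewrite (vb _ xb) orbT.
  + have := IH _ _ cI x xc; rewrite mem_cat; apply=> a' a'A.
    by apply: vA; rewrite inE a'A orbT.
(* Only the implications from members of [A] to [g] are kept: unlike [f] itself, they survive
   induction on [A]. *)
- suff gen (G : seq (hform t)) :
      (forall a : nnf, a \in A -> hder G (HImp (hclassical (hemb a)) g)) ->
      @ent hilbert G (cors hilbert (imps A B)).
    apply: gen => a /Af af; apply: hder_imp; apply: HD_mp; last first.
      exact: hder_imp_subst af (hder_head _ _).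
    by apply: hder_consW; apply: hder_head.
  elim: A {nA A0 vA fA Af} => [_|a A IH GA] /=.
    by apply: (hder_ax1 (HA_or1 _ _)); apply: hder_imp; apply: hder_head.
  apply: (@ent_cut hilbert _ (cors hilbert (imps A B))).
    by apply: IH => b bA; apply: GA; rewrite inE bA orbT.
  apply: (@ent_cors_under hilbert id (imps A B)) => //.
  + by move=> f' g'; apply: hder_head.
  + by elim: A {IH GA} => //= a' A; apply: pairs_neq0.
  + exact: hder_head.
  move=> c cI; apply: (@normal_formE hilbert (HImp (hclassical (hemb a))) _ _ _ _ _ _ nB).
  + move=> h k hk; apply: hder_imp; apply: hder_imp_subst hk _.
    by apply: HD_mp (hder_head _ _); apply: hder_consW; apply: hder_head.
  + move=> h k; apply: hder_ax1 (HA_split _ _ _) (hder_head _ _).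
  + by do 2!apply: hder_consW; apply: GA; rewrite inE eqxx.
  move=> b bB; apply: (@ent_cors hilbert _ _ (NAnd (NOr (ndual a) b) c)).
    exact: allpairs_f.
  apply: (ent_andI (c := hilbert)); last by apply: hder_consW; apply: hder_head.
  apply: hder_imp; apply: HD_mp; first by apply: hder_consW; apply: hder_head.
  apply: hder_raa; apply: HD_mp; first by apply: hder_consW; apply: hder_head.
  exact: hder_imp_subst (ent_neg_dual hilbert a) (hder_head _ _).
- move=> c cI; apply: hder_imp.
  suff elimA (G : seq (hform t)) (a : nnf) : a \in A -> hder G (hemb a) ->
      hder G (hemb c) -> hder G g.
    apply: (@normal_form_id hilbert f A _ _ nA); first exact: hder_head.
    move=> a aA; apply: (elimA _ a) => //; first exact: hder_head.
    by do 2!apply: hder_consW; apply: hder_head.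
  elim: A c cI {nA A0 vA fA Af} => //= a' A IH _ /allpairsP[[b c] /= [bB cI ->]].
  rewrite inE /= => /orP[/eqP->|aA] Ga Gc; last first.
    by apply: (IH c) => //; apply: hder_ax1 Gc; apply: HA_and2.
  apply: hder_imp_subst (Bg b bB) _.
  apply: HD_mp (hder_ax1 (HA_and1 _ _) Gc) _; apply: hder_imp.
  apply: (ent2 (ent_dual_negE hilbert a')); last exact: hder_head.
  exact: hder_consW.
Qed.

Lemma hder_weak_imp G f g : hder [:: f] g -> hder G (HImp f g).
Proof. by move=> fg; apply: hder_imp; apply: hder_imp_subst fg (hder_head _ _). Qed.

Lemma hder_tens_mono (h : t) f g k l :
  hder [:: f] k -> hder [:: g] l -> hder [:: HTens h f g] (HTens h k l).
Proof.
move=> /hder_imp fk /hder_imp gl.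
apply: HD_mp (hder_ax2 (HA_tensmono h f g k l) _ _) (hder_head _ _).
  by apply: hder_subst fk => ? [].
by apply: hder_subst gl => ? [].
Qed.

Lemma hnormal_form_with D f :
  hdeps (fun s b => @normal_form hilbert (HDep s b) (D s b)) f ->
  @normal_form hilbert f (hresolutions_with D f).
Proof.
elim: f => //= [x _|_|f IHf g IHg [/IHf nf /IHg ng]|h f IHf g IHg [/IHf nf /IHg ng]|
  f IHf g IHg [/IHf nf /IHg ng]|f IHf g IHg [/IHf nf /IHg ng]|f IH /IH|f IH /IH].
- by apply: (@normal_form_emb hilbert) => //; apply: hder_head.
- by apply: (@normal_form_emb hilbert) => //; apply: hder_head.
- exact: (@normal_form_and hilbert).
- apply: (@normal_form_tensor hilbert (HTens h)) => //.
  + by move=> *; apply: hder_tens_mono.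
  + by move=> f' g' k; apply: hder_ax1 (HA_tensor _ _ _ _) (hder_head _ _).
  + by move=> f' g'; apply: hder_ax1 (HA_tensC _ _ _) (hder_head _ _).
  + move=> a b; apply: HD_mp (hder_head _ _).
    apply: (@hder_ax2 _ _ _ _ (HA_tensE h _ _ (hemb (NOr a b)))).
      exact: hder_weak_imp (@ent_norI1 hilbert a b).
    exact: hder_weak_imp (@ent_norI2 hilbert a b).
  (* A tensor of classical formulas is classical, so reductio applies: its negation refutes
     [hemb a], hence [hemb b] holds, and with it the tensor. *)
  + move=> a b; apply: (@hder_raa _ (HCTens h (hemb a) (hemb b))).
    set G := (X in hder X _).
    have Gn : hder G (HImp (HTens h (hemb a) (hemb b)) HBot) by exact: hder_head.
    apply: (HD_mp Gn); apply: (hder_ax1 (HA_tensC h _ _)).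
    apply: (hder_ax1 (HA_tens1 h _ _)).
    apply: (@HD_mp _ _ (HImp (hemb a) HBot)); first by apply: HD_hyp; right; left.
    apply: hder_imp; apply: (HD_mp (hder_consW _ Gn)).
    by apply: (hder_ax1 (HA_tens1 h _ _)); apply: hder_head.
- exact: (@normal_form_or hilbert).
- exact: hnormal_form_imp.
- exact: (@normal_form_box hilbert).
- exact: (@normal_form_dia hilbert).
Qed.

Lemma hvars_classical (a : hcform t) : hvars a = hcvars a.
Proof. by elim: a => //= [a -> b ->|h a -> b ->|a -> b ->]. Qed.

Lemma hvars_dep_def (s : seq (hcform t)) b :
  {subset hvars (hdep_def s b) <= hvars (HDep s b)}.
Proof.
have em (c : hcform t) x : x \in hvars (hem c) -> x \in hcvars c.
  by rewrite /= hvars_classical cats0 mem_cat orbb => ->.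
have conj r f x : x \in hvars (hconj f [seq hem c | c <- r]) ->
    x \in hvars f ++ flatten [seq hcvars c | c <- r].
  elim: r f => [|c r IH] f; first by rewrite cats0.
  rewrite /= !mem_cat => /orP[->//|/IH].
  by rewrite mem_cat => /orP[/em ->|->]; rewrite !orbT.
case: s => [|a s] x; first by move=> /em xb; rewrite mem_cat xb orbT.
have -> : hvars (hdep_def (a :: s) b) =
    hvars (hconj (hem a) [seq hem c | c <- s]) ++ hvars (hem b) by [].
rewrite mem_cat => /orP[/conj|/em xb]; last by rewrite mem_cat xb orbT.
rewrite mem_cat => /orP[/em xa|xs]; first by rewrite /= !mem_cat xa.
by rewrite /= !mem_cat xs !orbT.
Qed.

Lemma hnormal_form f : @normal_form hilbert f (hresolutions f).
Proof.
apply: hnormal_form_with; apply: hdeps_all => s b.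
apply: (@normal_form_equiv hilbert _ (hdep_def s b)).
- exact: hvars_dep_def.
- apply: HD_mp (hder_head _ _).
  exact: hder_ax1 (HA_and1 _ _) (HD_ax _ (HA_dep s b)).
- apply: HD_mp (hder_head _ _).
  exact: hder_ax1 (HA_and2 _ _) (HD_ax _ (HA_dep s b)).
- by apply: hnormal_form_with; apply: hdeps_dep_def.
Qed.

Lemma hresolutions_neq0 f : hresolutions f != [::].
Proof. by case: (hnormal_form f). Qed.

(** * Soundness of the Hilbert systems *)

Definition hsupports d f : Prop := supports d (hresolutions f).

Lemma hsupports_sub d e f : subteam d e -> hsupports e f -> hsupports d f.
Proof. exact: supports_sub. Qed.

Lemma hsupports_empty d f : (forall u, ~ d u) -> hsupports d f.
Proof.
move=> d0; case E: (hresolutions f) (hresolutions_neq0 f) => [//|a A] _.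
by exists a; rewrite ?E ?inE ?eqxx // => u /d0.
Qed.

Lemma hsupports_bot d : hsupports d HBot <-> forall u, ~ d u.
Proof. exact: supports_false. Qed.

Lemma hsupports_and d f g :
  hsupports d (HAnd f g) <-> hsupports d f /\ hsupports d g.
Proof. exact: supports_ands. Qed.

Lemma hsupports_or d f g :
  hsupports d (HOr f g) <-> hsupports d f \/ hsupports d g.
Proof. exact: supports_cat. Qed.

Lemma hsupports_tens h d f g :
  hsupports d (HTens h f g) <->
  exists d1 d2, [/\ forall u, d u -> d1 u \/ d2 u, hsupports d1 f & hsupports d2 g].
Proof. exact: supports_tensors. Qed.

Lemma hsupports_imp d f g :
  hsupports d (HImp f g) <->
  forall e, subteam e d -> hsupports e f -> hsupports e g.
Proof. exact: supports_imps. Qed.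

Lemma hsupports_box d f : hsupports d (HBox f) <-> hsupports (successors d) f.
Proof. exact: supports_box. Qed.

Lemma hsupports_dia d f :
  hsupports d (HDia f) <->
  exists2 e : team, hsupports e f &
    forall u, d u -> exists2 v, List.In v (children u) & e v.
Proof. exact: supports_dia. Qed.

(** Flatness: a single resolution means that support is decided point by point. The cases
    [HA_split], [HA_dne], [HA_tensE] and [HA_nbox] of soundness rest on it. *)
Lemma hsupports_classical a :
  exists c, forall d, hsupports d a <-> forall u, d u -> sat c u.
Proof.
have [c ac] := hresolutions_classical a; exists c => d.
by rewrite /hsupports ac; apply: supports1.
Qed.

Lemma subteam_trans d1 d2 d3 : subteam d1 d2 -> subteam d2 d3 -> subteam d1 d3.
Proof. by move=> h1 h2 u /h1 /h2. Qed.

Lemma hsupports_mp d e f g :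
  hsupports d (HImp f g) -> subteam e d -> hsupports e f -> hsupports e g.
Proof. by move/hsupports_imp; apply. Qed.

Lemma successors_sub d e : subteam d e -> subteam (successors d) (successors e).
Proof. by move=> de v [u /de eu uv]; exists u. Qed.

Lemma haxiom_hsupports f : haxiom f -> forall d, hsupports d f.
Proof.
case=> {f}.
- move=> f g d; apply/hsupports_imp => e _ sf; apply/hsupports_imp => e' e'e _.
  exact: hsupports_sub sf.
- move=> f g k d; apply/hsupports_imp => e _ sfgk.
  apply/hsupports_imp => e1 e1e sfg; apply/hsupports_imp => e2 e21 sf.
  have := hsupports_mp sfgk (subteam_trans e21 e1e) sf.
  by move/hsupports_mp; apply=> //; apply: (hsupports_mp sfg).
- by move=> f g d; apply/hsupports_imp=> e _ /hsupports_and[].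
- by move=> f g d; apply/hsupports_imp=> e _ /hsupports_and[].
- move=> f k d; apply/hsupports_imp=> e _ sf; apply/hsupports_imp=> e' e'e sk.
  by apply/hsupports_and; split=> //; apply: hsupports_sub sf.
- by move=> f g d; apply/hsupports_imp=> e _ sf; apply/hsupports_or; left.
- by move=> f g d; apply/hsupports_imp=> e _ sf; apply/hsupports_or; right.
- move=> f g k d; apply/hsupports_imp=> e _ sfk.
  apply/hsupports_imp=> e1 e1e sgk; apply/hsupports_imp=> e2 e21.
  case/hsupports_or; last exact: (hsupports_mp sgk).
  exact: (hsupports_mp sfk (subteam_trans e21 e1e)).
- by move=> f d; apply/hsupports_imp=> e _ /hsupports_bot; apply: hsupports_empty.
- move=> a f g d; have [c ac] := hsupports_classical a.
  apply/hsupports_imp=> e _ safg; apply/hsupports_or.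
  (* The largest subteam of [e] supporting [a]: a disjunct supported here is inherited by all the
     others. *)
  pose e' u := e u /\ sat c u.
  have e'e : subteam e' e by move=> u [].
  have sub e2 : subteam e2 e -> hsupports e2 a -> subteam e2 e'.
    by move=> e2e /ac sa u e2u; split; [apply: e2e | apply: sa].
  have /hsupports_or[s|s] : hsupports e' (HOr f g).
  + by apply: (hsupports_mp safg) => //; apply/ac => u [].
  + left; apply/hsupports_imp => e2 e2e /(sub _ e2e) e2e'.
    exact: hsupports_sub s.
  + right; apply/hsupports_imp => e2 e2e /(sub _ e2e) e2e'.
    exact: hsupports_sub s.
- move=> a d; have [c ac] := hsupports_classical a.
  apply/hsupports_imp=> e _ nna; apply/ac => u eu.
  case: (boolP (sat c u)) => // nau; exfalso.
  (* On the singleton team of [u], failure of [c] at [u] supports the negation of [a], against the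
     double negation. *)
  have /hsupports_bot/(_ u) : hsupports (eq u) HBot; last exact.
  apply: (hsupports_mp nna) => [v <- //|].
  apply/hsupports_imp => e' e'u /ac sa; apply/hsupports_bot => v e'v.
  by move: (sa _ e'v) nau; rewrite -(e'u _ e'v) => ->.
- move=> f g d; apply/hsupports_imp => e _ /hsupports_box sfg.
  apply/hsupports_imp => e1 e1e /hsupports_box sf; apply/hsupports_box.
  by apply: (hsupports_mp sfg) => //; apply: successors_sub.
- move=> f g d; apply/hsupports_imp => e _ /hsupports_box sfg.
  apply/hsupports_imp => e1 e1e /hsupports_dia[x sx e1x]; apply/hsupports_dia.
  (* The implication is known only on successors of [e], so the witnessing team is first cut down to
     successors. *)
  exists (fun v => x v /\ successors e1 v).
    apply: (hsupports_mp sfg) => [v [_]|]; first exact: successors_sub.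
    by apply: hsupports_sub sx => v [].
  by move=> u e1u; have [v uv xv] := e1x u e1u; exists v => //; split=> //; exists u.
- move=> d; apply/hsupports_imp => e _ /hsupports_dia[x /hsupports_bot x0 ex].
  by apply/hsupports_bot => u /ex[v _ /x0].
- move=> f g d; apply/hsupports_imp => e _ /hsupports_dia[x /hsupports_or sx ex].
  by apply/hsupports_or; case: sx => sx; [left|right]; apply/hsupports_dia; exists x.
- move=> f g d; apply/hsupports_imp => e _ sdb; apply/hsupports_box.
  apply/hsupports_imp => x xe sf.
  (* The points of [e] that see [x] support the diamond, hence the box; [x] lies among their
     successors. *)
  pose e' u := e u /\ exists2 v, List.In v (children u) & x v.
  have : hsupports e' (HBox g).
    apply: (hsupports_mp sdb) => [u []//|]; apply/hsupports_dia.
    by exists x => // u [].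
  move/hsupports_box; apply: hsupports_sub => v xv.
  by have [u eu uv] := xe v xv; exists u => //; split=> //; exists v.
- move=> s b d; apply/hsupports_and; split; apply/hsupports_imp => e _;
  by rewrite /hsupports hresolutions_dep.
- move=> h f g d; apply/hsupports_imp => e _ sf; apply/hsupports_tens.
  exists e, (fun _ => False); split=> //; first by left.
  by apply: hsupports_empty => u [].
- move=> h f g a d; have [c ac] := hsupports_classical a.
  apply/hsupports_imp => e _ sfa; apply/hsupports_imp => e1 e1e sga.
  apply/hsupports_imp => e2 e21 /hsupports_tens[d1 [d2 [e2d sf sg]]].
  apply/ac => u e2u; have: hsupports (eq u) a; last by move/ac; apply.
  case: (e2d u e2u) => du.
    apply: (hsupports_mp sfa) => [v <-|]; first by apply: e1e; apply: e21.
    by apply: hsupports_sub sf => v <-.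
  apply: (hsupports_mp sga) => [v <-|]; first exact: e21.
  by apply: hsupports_sub sg => v <-.
- move=> h f g k l d; apply/hsupports_imp => e _ sfk.
  apply/hsupports_imp => e1 e1e sgl.
  apply/hsupports_imp => e2 e21 /hsupports_tens[d1 [d2 [e2d sf sg]]].
  apply/hsupports_tens; exists (fun u => d1 u /\ e2 u), (fun u => d2 u /\ e2 u).
  split; first by move=> u e2u; case: (e2d u e2u); [left|right].
    apply: (hsupports_mp sfk) => [u [_ /e21 /e1e] //|].
    by apply: hsupports_sub sf => u [].
  apply: (hsupports_mp sgl) => [u [_ /e21] //|].
  by apply: hsupports_sub sg => u [].
- move=> h f g d; apply/hsupports_imp => e _ /hsupports_tens[d1 [d2 [ed sf sg]]].
  by apply/hsupports_tens; exists d2, d1; split=> // u /ed[]; [right|left].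
- move=> h f g k d; apply/hsupports_imp => e _.
  move=> /hsupports_tens[d1 [d2 [ed sf /hsupports_tens[d3 [d4 [dd sg sk]]]]]].
  apply/hsupports_tens; exists (fun u => d1 u \/ d3 u), d4; split=> //.
    by move=> u /ed[|/dd[]]; [left; left|left; right|right].
  by apply/hsupports_tens; exists d1, d3.
- move=> h f g k d; apply/hsupports_imp => e _.
  move=> /hsupports_tens[d1 [d2 [ed sf /hsupports_or sgk]]]; apply/hsupports_or.
  by case: sgk => s; [left|right]; apply/hsupports_tens; exists d1, d2.
- move=> a d; have [c ac] := hsupports_classical a.
  apply/hsupports_imp => e _ nba; apply/hsupports_dia.
  exists (fun v => sat (ndual c) v).
    apply/hsupports_imp => x xc /ac sx; apply/hsupports_bot => v xv.
    by move: (xc v xv); rewrite sat_dual (sx v xv).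
  move=> u eu; case: (boolP (sat (NDia (ndual c)) u)).
    by case/sat_diaP=> v [uv cv]; exists v.
  rewrite -[NDia _]/(ndual (NBox c)) sat_dual negbK => /sat_boxP bc; exfalso.
  have /hsupports_bot/(_ u) : hsupports (eq u) HBot; last exact.
  apply: (hsupports_mp nba) => [v <- //|]; apply/hsupports_box/ac.
  by move=> v [w <-]; apply: bc.
- move=> f g d; apply/hsupports_imp => e _ /hsupports_box /hsupports_or sfg.
  by apply/hsupports_or; case: sfg; [left|right]; apply/hsupports_box.
Qed.

Lemma hder_hsupports (G : seq (hform t)) f :
  hder G f -> forall d, (forall g, List.In g G -> hsupports d g) -> hsupports d f.
Proof.
elim=> {G f} [G f Gf d sG|G f /haxiom_hsupports //|G f g _ IHfg _ IHf d sG|G f _ IH d sG].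
- exact: sG.
- exact: hsupports_mp (IHfg d sG) _ (IHf d sG).
- by apply/hsupports_box/IH.
Qed.

Lemma hder_interpolation f g (q : seq nat) :
  hder [:: f] g -> (forall x, x \in hvars f -> x \in hvars g -> x \in q) ->
  exists theta, [/\ {subset hvars theta <= q}, hder [:: f] theta &
                    hder [:: theta] g].
Proof.
move=> fg vq.
apply: (@calculus_interpolation hilbert _ _ _ _ _ (hnormal_form f) (hnormal_form g)) => //.
move=> d df; apply: (hder_hsupports fg) => k [<-//|[]].
Qed.

End Hilbert.

(** * MDv *)

Fixpoint dnnf (a : dcform) : nnf :=
  match a with
  | DCVar x => NLit true x
  | DCBot => NConst false
  | DCNeg a => ndual (dnnf a)
  | DCAnd a b => NAnd (dnnf a) (dnnf b)
  | DCTens a b => NOr (dnnf a) (dnnf b)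
  | DCBox a => NBox (dnnf a)
  | DCDia a => NDia (dnnf a)
  end.

Fixpoint dresolutions_with (D : seq dcform -> dcform -> seq nnf) (f : dform) :
    seq nnf :=
  match f with
  | DVar x => [:: NLit true x]
  | DBot => [:: NConst false]
  | DNeg a => [:: ndual (dnnf a)]
  | DDep s b => D s b
  | DAnd f g => ands (dresolutions_with D f) (dresolutions_with D g)
  | DTens f g => tensors (dresolutions_with D f) (dresolutions_with D g)
  | DOr f g => dresolutions_with D f ++ dresolutions_with D g
  | DBox f => map NBox (dresolutions_with D f)
  | DDia f => map NDia (dresolutions_with D f)
  end.

Fixpoint ddeps (P : seq dcform -> dcform -> Prop) (f : dform) : Prop :=
  match f with
  | DVar _ | DBot | DNeg _ => True
  | DDep s b => P s b
  | DAnd f g | DTens f g | DOr f g => ddeps P f /\ ddeps P g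
  | DBox f | DDia f => ddeps P f
  end.

Definition dresolutions : dform -> seq nnf :=
  dresolutions_with (fun s b => dresolutions_with (fun _ _ => [::]) (ddep_def s b)).

Lemma ddeps_all (P : seq dcform -> dcform -> Prop) (f : dform) :
  (forall s b, P s b) -> ddeps P f.
Proof. by move=> allP; elim: f => /=. Qed.

Lemma ddeps_classical P (a : dcform) : ddeps P a.
Proof. by elim: a => /=. Qed.

Lemma dtensors_ind (Q : dform -> Prop) (I : Type) (F : I -> dform) (s : seq I) :
  Q DBot -> (forall f g, Q f -> Q g -> Q (DTens f g)) -> (forall i, Q (F i)) ->
  Q (dtensors (map F s)).
Proof.
move=> Q0 QT QF; elim: s => //= i [|j s] IH /=; first exact: QF.
by apply: QT; first exact: QF.
Qed.

Lemma ddeps_dep_def P (s : seq dcform) (b : dcform) : ddeps P (ddep_def s b).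
Proof.
apply: dtensors_ind => // v; rewrite /ddep_case.
elim: (zip v s) => [|[[] c] r IH] /=; do ?split=> //; exact: ddeps_classical.
Qed.

Lemma dresolutions_with_eq D D' (f : dform) :
  ddeps (fun s b => D s b = D' s b) f ->
  dresolutions_with D f = dresolutions_with D' f.
Proof.
elim: f => //= [f IHf g IHg|f IHf g IHg|f IHf g IHg|f IH|f IH];
by move=> [] * || move=> *; rewrite ?IHf ?IHg ?IH.
Qed.

Lemma dresolutions_dep (s : seq dcform) (b : dcform) :
  dresolutions (DDep s b) = dresolutions (ddep_def s b).
Proof.
by rewrite /dresolutions /=; apply: dresolutions_with_eq; exact: ddeps_dep_def.
Qed.

Lemma dresolutions_with_classical D (a : dcform) :
  dresolutions_with D a = [:: dnnf a].
Proof. by elim: a => //= [a -> b ->|a -> b ->|a ->|a ->]. Qed.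

Section NaturalDeduction.
Implicit Types (f g k : dform) (a : dcform) (d e : team) (G H : seq dform).

Lemma in_cons_sub (T : Type) (G H : seq T) x :
  (forall y, List.In y G -> List.In y H) ->
  forall y, List.In y (x :: G) -> List.In y (x :: H).
Proof. by move=> GH y [->|/GH]; [left|right]. Qed.

Lemma dder_weak G H f :
  (forall g, List.In g G -> List.In g H) -> dder G f -> dder H f.
Proof.
move=> GH dG; elim: dG H GH => {G f} *;
  by econstructor; eauto using in_cons_sub.
Qed.

Lemma dder_head G f : dder (f :: G) f.
Proof. by apply: DD_hyp; left. Qed.

Lemma dder_consW G f g : dder G f -> dder (g :: G) f.
Proof. by apply: dder_weak => k Gk; right. Qed.

Lemma dder_subst G H f :
  (forall g, List.In g G -> dder H g) -> dder G f -> dder H f.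
Proof.
have consS F K g : (forall k, List.In k F -> dder K k) ->
    forall k, List.In k (g :: F) -> dder (g :: K) k.
  by move=> FK k [<-|/FK Kk]; [apply: dder_head|apply: dder_consW].
move=> GH dG; elim: dG H GH => {G f}; first by move=> G f Gf H; apply.
all: by move=> *; econstructor; eauto using consS.
Qed.

Lemma dder_raa G a : dder (DNeg a :: G) DBot -> dder G a.
Proof. by move=> h; apply/DD_dne/(DD_negI (a := DCNeg a)). Qed.

Lemma dder_dia1 f g : dder [:: f] g -> dder [:: DDia f] (DDia g).
Proof. exact: DD_dia (dder_head _ _). Qed.

Fixpoint demb (a : nnf) : dcform :=
  match a with
  | NConst b => if b then DCNeg DCBot else DCBot
  | NLit b x => if b then DCVar x else DCNeg (DCVar x)
  | NAnd a b => DCAnd (demb a) (demb b)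
  | NOr a b => DCTens (demb a) (demb b)
  | NBox a => DCBox (demb a)
  | NDia a => DCDia (demb a)
  end.

Lemma dvars_classical a : dvars a = dcvars a.
Proof. by elim: a => //= [a -> b ->|a -> b ->]. Qed.

Definition natural_deduction : calculus.
Proof.
refine (@Calculus dform dvars dder DBot DAnd DOr DBox DDia
  (fun a : nnf => dclassical (demb a)) (fun a : nnf => DNeg (demb a))
  _ _ _ _ _ _ _ _ _ _ _ _ _ _ _ _ _ _ _ _ _ _ _ _ _ _ _ _ _ _ _ _ _ _ _) => //.
- elim=> //= [[]|[] x|a IHa b IHb|a IHa b IHb] //= x;
  by rewrite !mem_cat => /orP[/IHa|/IHb] ->; rewrite ?orbT.
- exact: DD_hyp.
- exact: dder_subst.
- exact: DD_botE.
- exact: DD_andI.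
- exact: DD_andE1.
- exact: DD_andE2.
- exact: DD_orI1.
- exact: DD_orI2.
- exact: DD_orE.
- move=> G f; apply: DD_box => g gG; apply: DD_hyp.
  by apply/List.in_map.
- exact: dder_dia1.
- by move=> f g; apply: DD_boxor; apply: dder_head.
- by move=> f g; apply: DD_diaor; apply: dder_head.
- by move=> G; apply: DD_negI; apply: dder_head.
- move=> [] x; apply: (@DD_negE _ (DCVar x)); by apply: DD_hyp; [left + (right; left)].
- move=> [] x; first exact: dder_head.
  by apply: DD_dne; apply: dder_head.
- by move=> G a; apply: DD_negI.
- by move=> a; apply: (@DD_negE _ (demb a)); apply: DD_hyp; [left|right; left].
- by move=> G a; apply: dder_raa.
- by move=> a b; apply: DD_tensI; apply: dder_head.
- by move=> a b; apply: DD_tensC; apply: DD_tensI; apply: dder_head.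
- by move=> G a b ab ha hb; apply: (DD_tensE (a := DCBot) ab).
- by move=> a; apply: DD_negbox; apply: dder_head.
(* The duality rules exchange only [DNeg] of a box and a diamond of [DNeg], so the goal goes by
   reductio: its negation gives a diamond of a double negation, which is cancelled inside. The next
   case inserts a double negation in the same way. *)
- move=> a; apply: (@dder_raa _ (DCBox (DCNeg (demb a)))).
  apply: (@DD_negE _ (DCDia (demb a))); last by apply: dder_consW; apply: dder_head.
  apply: (@DD_dia _ (DNeg (DCNeg (demb a)))).
    by apply: DD_negbox; apply: dder_head.
  by apply: DD_dne; apply: dder_head.
- move=> a; apply: (@DD_negE _ (DCBox (DCNeg (demb a)))).
    by apply: DD_hyp; right; left.
  apply: (@DD_dianeg _ (DCNeg (demb a))); apply: (@DD_dia _ (demb a)).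
    exact: dder_head.
  apply: (@DD_negI _ (DCNeg (demb a))); apply: (@DD_negE _ (demb a)).
    by apply: dder_consW; apply: dder_head.
  exact: dder_head.
Defined.

Lemma dder_tens_mono f g h k :
  dder [:: f] h -> dder [:: g] k -> dder [:: DTens f g] (DTens h k).
Proof.
move=> fh gk; apply: (@DD_tensmono _ _ g); last first.
  by apply: dder_subst gk => ? [<-|[]]; apply: dder_head.
apply: DD_tensC; apply: (@DD_tensmono _ _ f); last first.
  by apply: dder_subst fh => ? [<-|[]]; apply: dder_head.
by apply: DD_tensC; apply: dder_head.
Qed.

Lemma dnormal_form_tensor f g (A B : seq nnf) :
  @normal_form natural_deduction f A -> @normal_form natural_deduction g B ->
  @normal_form natural_deduction (DTens f g) (tensors A B).
Proof.
apply: (@normal_form_tensor natural_deduction DTens) => //.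
- exact: dder_tens_mono.
- by move=> f' g' h; apply: DD_tensor; apply: dder_head.
- by move=> f' g'; apply: DD_tensC; apply: dder_head.
- by move=> a b; apply: dder_head.
- by move=> a b; apply: dder_head.
Qed.

(** [DNeg a] negates [a] itself and not [demb (dnnf a)]; the hypothesis makes these two
    interderivable, and [ent_neg_dual] then moves the negation inside. *)
Lemma dnormal_form_neg a :
  @normal_form natural_deduction a [:: dnnf a] ->
  @normal_form natural_deduction (DNeg a) [:: ndual (dnnf a)].
Proof.
move=> [_ va ac ca]; apply: (@normal_form_emb natural_deduction).
- move=> x; rewrite nvars_dual => /(va _ (mem_head _ _)).
  by rewrite /= dvars_classical.
- apply: (ent1 (C := natural_deduction)) (ent_neg_dual natural_deduction (dnnf a)) _.
  apply: DD_negI; apply: (@DD_negE _ a); last by apply: dder_consW; apply: dder_head.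
  apply: dder_subst (ca _ (mem_head _ _)) => ? [<-|[]]; exact: dder_head.
- apply: DD_negI; apply: (ent2 (C := natural_deduction))
    (ent_dual_negE natural_deduction (dnnf a)) _ _.
    (* Even for a single resolution, [cors] ends in a falsum disjunct, which is eliminated here. *)
    apply: DD_orE (dder_subst _ ac) _ _ => [? [<-|[]]||].
    + exact: dder_head.
    + exact: dder_head.
    + by apply: DD_botE; apply: dder_head.
  by apply: dder_consW; apply: dder_head.
Qed.

Lemma dnormal_form_classical a : @normal_form natural_deduction a [:: dnnf a].
Proof.
elim: a => /= [x||a|a IHa b IHb|a IHa b IHb|a IH|a IH].
- by apply: (@normal_form_emb natural_deduction) => //; apply: dder_head.
- by apply: (@normal_form_emb natural_deduction) => //; apply: dder_head.
- exact: dnormal_form_neg.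
- exact: normal_form_and IHa IHb.
- exact: dnormal_form_tensor IHa IHb.
- exact: normal_form_box IH.
- exact: normal_form_dia IH.
Qed.

Lemma dnormal_form_with D f :
  ddeps (fun s b => @normal_form natural_deduction (DDep s b) (D s b)) f ->
  @normal_form natural_deduction f (dresolutions_with D f).
Proof.
elim: f => //= [x _|_|a _|f IHf g IHg [/IHf nf /IHg ng]|f IHf g IHg [/IHf nf /IHg ng]|
  f IHf g IHg [/IHf nf /IHg ng]|f IH /IH nf|f IH /IH nf].
- exact: (dnormal_form_classical (DCVar x)).
- exact: (dnormal_form_classical DCBot).
- exact/dnormal_form_neg/dnormal_form_classical.
- exact: normal_form_and nf ng.
- exact: dnormal_form_tensor.
- exact: normal_form_or nf ng.
- exact: normal_form_box nf.
- exact: normal_form_dia nf.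
Qed.

Lemma dvars_dep_def (s : seq dcform) (b : dcform) :
  {subset dvars (ddep_def s b) <= dvars (DDep s b)}.
Proof.
pose V f := {subset dvars f <= dvars (DDep s b)}.
apply: (@dtensors_ind V) => [//|f g Vf Vg x|v].
  by rewrite mem_cat => /orP[/Vf|/Vg].
suff gen r : {subset dvars (foldr DAnd (dem b) [seq dsigned va.1 va.2 | va <- zip v r]) <=
    dvars (DDep r b)} by exact: gen.
elim: r v => [|c r IH] [|[] v] x /=; rewrite ?dvars_classical.
all: rewrite ?mem_cat ?orbb; try by move=> ->; rewrite ?orbT.
all: by case/orP=> [->//|/IH]; rewrite mem_cat -orbA => ->; rewrite orbT.
Qed.

Lemma dnormal_form f : @normal_form natural_deduction f (dresolutions f).
Proof.
apply: dnormal_form_with; apply: ddeps_all => s b.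
apply: (@normal_form_equiv natural_deduction _ (ddep_def s b)).
- exact: dvars_dep_def.
- by apply: DD_depE; apply: dder_head.
- by apply: DD_depI; apply: dder_head.
- by apply: dnormal_form_with; apply: ddeps_dep_def.
Qed.

(** * Soundness of natural deduction *)

Definition dsupports d f : Prop := supports d (dresolutions f).

Lemma dsupports_sub d e f : subteam d e -> dsupports e f -> dsupports d f.
Proof. exact: supports_sub. Qed.

Lemma dsupports_and d f g :
  dsupports d (DAnd f g) <-> dsupports d f /\ dsupports d g.
Proof. exact: supports_ands. Qed.

Lemma dsupports_or d f g :
  dsupports d (DOr f g) <-> dsupports d f \/ dsupports d g.
Proof. exact: supports_cat. Qed.

Lemma dsupports_tens d f g :
  dsupports d (DTens f g) <->
  exists d1 d2, [/\ forall u, d u -> d1 u \/ d2 u, dsupports d1 f & dsupports d2 g].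
Proof. exact: supports_tensors. Qed.

Lemma dsupports_box d f : dsupports d (DBox f) <-> dsupports (successors d) f.
Proof. exact: supports_box. Qed.

Lemma dsupports_dia d f :
  dsupports d (DDia f) <->
  exists2 e : team, dsupports e f &
    forall u, d u -> exists2 v, List.In v (children u) & e v.
Proof. exact: supports_dia. Qed.

Lemma dsupports_bot d : dsupports d DBot <-> forall u, ~ d u.
Proof. exact: supports_false. Qed.

Lemma dsupports_classical d a : dsupports d a <-> forall u, d u -> sat (dnnf a) u.
Proof. by rewrite /dsupports /dresolutions dresolutions_with_classical; apply: supports1. Qed.

Lemma dsupports_neg d a : dsupports d (DNeg a) <-> forall u, d u -> ~~ sat (dnnf a) u.
Proof.
split=> [/(dsupports_classical d (DCNeg a)) h u /h|h]; first by rewrite sat_dual.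
by apply/(dsupports_classical d (DCNeg a)) => u /h; rewrite sat_dual.
Qed.

Lemma dsupports_empty d f : (forall u, ~ d u) -> dsupports d f.
Proof.
move=> d0; have [] := dnormal_form f; rewrite /dsupports.
by case: (dresolutions f) => // a A _ _ _ _; exists a; rewrite ?inE ?eqxx // => u /d0.
Qed.

Lemma dder_dsupports G f :
  dder G f -> forall d, (forall g, List.In g G -> dsupports d g) -> dsupports d f.
Proof.
have consS d e F k : subteam e d -> dsupports e k ->
    (forall g, List.In g F -> dsupports d g) ->
    forall g, List.In g (k :: F) -> dsupports e g.
  by move=> ed ek dF g [<-//|/dF]; apply: dsupports_sub.
elim=> {G f}.
- by move=> G f Gf d; apply.
- by move=> G f g _ IH1 _ IH2 d dG; apply/dsupports_and; split; [apply: IH1|apply: IH2].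
- by move=> G f g _ IH d /IH /dsupports_and[].
- by move=> G f g _ IH d /IH /dsupports_and[].
- move=> G a _ IH d /IH /dsupports_neg h; apply/dsupports_classical => u /h /=.
  by rewrite sat_dual negbK.
- by move=> G f _ IH d /IH /dsupports_bot; apply: dsupports_empty.
- move=> G a _ IH d dG; apply/dsupports_neg => u du; apply/negP => au.
  have /dsupports_bot/(_ u) : dsupports (eq u) DBot; last exact.
  apply: IH; apply: consS dG => [v <- //|].
  by apply/dsupports_classical => v <-.
- move=> G a _ IH1 _ IH2 d dG; apply/dsupports_bot => u du.
  have /dsupports_classical/(_ u du) := IH1 d dG.
  by have /dsupports_neg/(_ u du) := IH2 d dG => /negP.
- move=> G D g _ IH1 _ IH2 d dG; apply/dsupports_box/IH2 => f fD.
  exact/dsupports_box/IH1.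
- move=> G f g _ IH1 _ IH2 d /IH1 /dsupports_dia[e ef de]; apply/dsupports_dia.
  by exists e => //; apply: IH2 => ? [<-|[]].
- move=> G a _ IH d /IH /dsupports_neg h; apply/dsupports_dia.
  exists (fun v => ~~ sat (dnnf a) v); first exact/dsupports_neg.
  move=> u /h; rewrite -sat_dual => /sat_diaP[v [uv]]; rewrite sat_dual.
  by exists v.
- move=> G a _ IH d /IH /dsupports_dia[e /dsupports_neg ea de].
  apply/dsupports_neg => u /de[v uv ev]; rewrite -sat_dual; apply/sat_diaP.
  by exists v; rewrite sat_dual; split=> //; apply: ea.
- by move=> G f g _ IH d /IH h; apply/dsupports_or; left.
- by move=> G f g _ IH d /IH h; apply/dsupports_or; right.
- move=> G f g k _ IH _ IH1 _ IH2 d dG.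
  by case/dsupports_or: (IH d dG) => h; [apply: IH1|apply: IH2]; apply: consS dG.
- move=> G f g k _ IH d /IH /dsupports_tens[d1 [d2 [dd sf /dsupports_or sgk]]].
  by apply/dsupports_or; case: sgk => s; [left|right]; apply/dsupports_tens; exists d1, d2.
- move=> G f g _ IH d /IH /dsupports_dia[e /dsupports_or se de].
  by apply/dsupports_or; case: se => s; [left|right]; apply/dsupports_dia; exists e.
- move=> G f g _ IH d /IH /dsupports_box /dsupports_or se.
  by apply/dsupports_or; case: se => s; [left|right]; apply/dsupports_box.
- move=> G f g _ IH d /IH sf; apply/dsupports_tens; exists d, (fun _ => False).
  by split=> //; [left|apply: dsupports_empty => u []].
- move=> G f g _ IH d /IH /dsupports_tens[d1 [d2 [dd sf sg]]]; apply/dsupports_tens.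
  by exists d2, d1; split=> // u /dd[]; [right|left].
- move=> G f g k _ IH d /IH.
  move=> /dsupports_tens[d1 [d2 [ed sf /dsupports_tens[d3 [d4 [dd sg sk]]]]]].
  apply/dsupports_tens; exists (fun u => d1 u \/ d3 u), d4; split=> //.
    by move=> u /ed[|/dd[]]; [left; left|left; right|right].
  by apply/dsupports_tens; exists d1, d3.
- move=> G f g a _ IH _ IH1 _ IH2 d dG.
  have /dsupports_tens[d1 [d2 [dd sf sg]]] := IH d dG.
  (* The conclusion is classical, so it may be checked on singletons; each of these lies inside one
     of the two parts. *)
  apply/dsupports_classical => u du; have: dsupports (eq u) a; last first.
    by move/dsupports_classical; apply.
  case: (dd u du) => d'u; [apply: IH1|apply: IH2]; apply: consS dG => [v <-//|].
    by apply: dsupports_sub sf => v <-.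
  by apply: dsupports_sub sg => v <-.
- move=> G f g k _ IH _ IH1 d dG.
  have /dsupports_tens[d1 [d2 [dd sf sg]]] := IH d dG.
  (* The second part is restricted to [d] because the subderivation may use the context, which is
     supported on [d] only. *)
  apply/dsupports_tens; exists d1, (fun u => d2 u /\ d u); split=> //.
    by move=> u du; case: (dd u du); [left|right].
  apply: IH1; apply: consS dG => [u []//|].
  by apply: dsupports_sub sg => u [].
- by move=> G s b _ IH d /IH; rewrite /dsupports dresolutions_dep.
- by move=> G s b _ IH d /IH; rewrite /dsupports dresolutions_dep.
Qed.

Lemma dder_interpolation f g (q : seq nat) :
  dder [:: f] g -> (forall x, x \in dvars f -> x \in dvars g -> x \in q) ->
  exists theta, [/\ {subset dvars theta <= q}, dder [:: f] theta &
                    dder [:: theta] g].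
Proof.
move=> fg vq.
apply: (@calculus_interpolation natural_deduction _ _ _ _ _
  (dnormal_form f) (dnormal_form g)) => // d df.
by apply: (dder_dsupports fg) => k [<-|[]].
Qed.

End NaturalDeduction.

Theorem theorem2p16 (L : logic) (p q r : seq nat)
    (hpq : disjoint_seq p q) (hpr : disjoint_seq p r) (hqr : disjoint_seq q r)
    (phi psi : formula L)
    (hphi : {subset vars phi <= p ++ q}) (hpsi : {subset vars psi <= q ++ r}) :
  entails phi psi ->
  exists theta : formula L,
    [/\ {subset vars theta <= q}, entails phi theta & entails theta psi].
Proof.
move=> phipsi.
have vq x : x \in vars phi -> x \in vars psi -> x \in q.
  move=> /hphi; rewrite mem_cat => /orP[xp|//] /hpsi; rewrite mem_cat.
  by case/orP=> // xr; move: (hpr x xp); rewrite xr.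
case: L phi psi phipsi vq {hphi hpsi} => phi psi.
- exact: hder_interpolation.
- exact: hder_interpolation.
- exact: dder_interpolation.
Qed.
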